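(* Consider the tolerance design problem $$\min_{v\in\mathbb{R}^{n+j}_+}E(v)\quad\text{s.t.}\quad W(v)\le\Delta W+W(\mathcal{D}),\quad v\ge\underline{v},$$ with $$E(v)=\left(\int_{\mathcal{X}}w(p)^q\,\epsilon_v(p)^q\,dp\right)^{1/q},\qquad W(v)=\sum_{i=1}^{n+j}v_i^s,$$ all quantities being as defined in the context. For exponents $2\le q<\infty$ and $s\ge1$, this problem is convex, i.e. $E$ is convex and the admissible set $\{v\in\mathbb{R}^{n+j}_+ : v\ge\underline{v},\ W(v)\le\Delta W+W(\mathcal{D})\}$ is convex. If, in addition, the covariance kernel is strictly positive, the design problem has a unique solution.
   Context: $\mathcal{X}\subset\mathbb{R}^d$ is closed and bounded (with positive Lebesgue measure), and $\mathbb{R}_+=[0,\infty)$. A current design $\mathcal{D}$ consists of distinct evaluation points $p_1,\dots,p_n\in\mathcal{X}$ with evaluation tolerances $\epsilon_1,\dots,\epsilon_n\in(0,\infty)$; additionally there are $j$ distinct candidate points $p_{n+1},\dots,p_{n+j}\in\mathcal{X}\setminus\{p_1,\dots,p_n\}$. The design variable is $v=(v_1,\dots,v_{n+j})$, $v_i=\epsilon_i^{-2}\ge0$, where $v_i=0$ means no evaluation at $p_i$. Covariance and posterior variance. Let $k:\mathbb{R}^d\times\mathbb{R}^d\to\mathbb{R}$ be a continuous, symmetric, translation-invariant ($k(p+a,p'+a)=k(p,p')$) positive definite covariance kernel. It is called strictly positive if $k(p,p')>0$ for all $p,p'$. For $p\in\mathcal{X}$ let $K(p)\in\mathbb{R}^{(n+j+1)\times(n+j+1)}$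 be the covariance matrix with entries $k(x_a,x_b)$ for $(x_1,\dots,x_{n+j+1})=(p_1,\dots,p_{n+j},p)$, and let $V=\mathrm{diag}(v_1,\dots,v_{n+j},0)$. The posterior variance at $p$ is $$\sigma_v^2(p)=e_{n+j+1}^T\left[K(p)^{-1}+V\right]^{-1}e_{n+j+1},$$ with $[K^{-1}+V]^{-1}$ read as $(I+KV)^{-1}K$ when $K$ is singular (e.g. when $p$ is one of the $p_i$); $e_i$ is the $i$-th unit vector. For model outputs in $\mathbb{R}^m$ with independent components, each component is treated separately in this way with its own continuous, symmetric, translation-invariant positive definite covariance kernel $\mathbb{R}^d\times\mathbb{R}^d\to\mathbb{R}$ (all assumed strictly positive when ''the kernel'' is), with the same $v$, and $\sigma_v(p)$ denotes the $m\times m$ diagonal matrix of the component standard deviations (for $m=1$ a scalar). Error model. $\epsilon_v(p)^q$ is one of the two expressions $$\epsilon_v(p)^q=\left(m\left(1-\tfrac{2}{9m}\right)^3\right)^{q/2}\|\sigma_v(p)\|_2^q\quad\text{or}\quad\epsilon_v(p)^q=\mathrm{tr}\left(\sigma_v(p)^q\right),$$ where $\|\cdot\|_2$ is the spectral norm; the statement is for either choice. The weight $w:\mathcal{X}\to(0,\infty)$ is a fixed, bounded measurable function not depending on $v$; in the paper $w(p)=(1+\alpha e_0(p))^{-1}\left(12L^{-1}\|\Sigma_l^{-1}\|C_1+\beta C_2^{-1}\right)$ with positive quantities $L,C_1,C_2,e_0$ (possibly depending on $p$), $\alpha,\beta\ge0$, and measurement covariance $\Sigma_l$, or an estimate of this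 expression. Work model. $W(\mathcal{D})=\sum_{i=1}^n\epsilon_i^{-2s}$, and $\Delta W>0$ is the incremental budget. The lower bound is $\underline{v}=(\epsilon_1^{-2},\dots,\epsilon_n^{-2},0,\dots,0)\in\mathbb{R}^{n+j}$, and $v\ge\underline{v}$ is understood componentwise. *)

(* Defs.v *)
From HB Require Import structures.
From mathcomp Require Import all_boot all_order all_algebra.
From mathcomp Require Import all_classical all_reals all_analysis.

Set Implicit Arguments.
Unset Strict Implicit.
Unset Printing Implicit Defensive.

Import Order.TTheory GRing.Theory Num.Theory.
Import numFieldNormedType.Exports.

Local Open Scope classical_set_scope.
Local Open Scope ring_scope.

Definition measure_rV_display : measure_display.
Proof. exact: default_measure_display. Qed.

Section measurable_rV.
Context {R : realType}.
Variable d : nat.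

Let coord (i : 'I_d) (x : 'rV[R]_d) : R := x ord0 i.

Let rV_set0 : g_sigma_preimage coord set0.
Proof. exact: sigma_algebra0. Qed.

Let rV_setC A : g_sigma_preimage coord A -> g_sigma_preimage coord (~` A).
Proof. exact: sigma_algebraC. Qed.

Let rV_bigcup (F : _^nat) : (forall i, g_sigma_preimage coord (F i)) ->
  g_sigma_preimage coord (\bigcup_i (F i)).
Proof. exact: sigma_algebra_bigcup. Qed.

HB.instance Definition _ := @isMeasurable.Build measure_rV_display
  'rV[R]_d (g_sigma_preimage coord) rV_set0 rV_setC rV_bigcup.

End measurable_rV.

Lemma measurable_coord (R : realType) d (i : 'I_d) :
  measurable_fun [set: 'rV[R]_d] (fun x => x ord0 i : R).
Proof.
move=> _ Y mY; rewrite setTI; apply: sub_sigma_algebra => /=.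
rewrite -bigcup_seq/=; exists i => /=; first by rewrite mem_index_enum.
by exists Y => //; rewrite setTI.
Qed.

Lemma measurable_fun_rVP (R : realType) d dT (T : measurableType dT)
    (f : T -> 'rV[R]_d) :
  (forall i, measurable_fun [set: T] (fun t => f t ord0 i : R)) ->
  measurable_fun [set: T] f.
Proof.
move=> mf.
suff : g_sigma_preimage (fun i t => f t ord0 i : R) `<=` measurable.
  rewrite (g_sigma_preimage_comp (fun i (x : 'rV[R]_d) => x ord0 i : R) f).
  by move=> + _ A mA; apply; exists A.
apply: smallest_sub; first exact: sigma_algebra_measurable.
rewrite -bigcup_seq/= => A [i _ [B mB <-]].
exact: mf.
Qed.

Definition rV_cons {R : realType} d (xy : R * 'rV[R]_d) : 'rV[R]_d.+1 :=
  \row_i (if unlift ord0 i is Some j then xy.2 ord0 j else xy.1).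

Lemma rV_cons0 (R : realType) d (xy : R * 'rV[R]_d) :
  rV_cons xy ord0 ord0 = xy.1.
Proof. by rewrite mxE unlift_none. Qed.

Lemma rV_consS (R : realType) d (xy : R * 'rV[R]_d) i :
  rV_cons xy ord0 (lift ord0 i) = xy.2 ord0 i.
Proof. by rewrite mxE liftK. Qed.

Lemma measurable_rV_cons (R : realType) d :
  measurable_fun [set: R * 'rV[R]_d] (@rV_cons R d).
Proof.
apply: measurable_fun_rVP => i.
case: (unliftP ord0 i) => [j|] ->.
  under eq_fun do rewrite rV_consS.
  apply: (@measurableT_comp _ _ _ _ _ _ (fun y : 'rV[R]_d => y ord0 j : R)).
    exact: measurable_coord.
  exact: measurable_snd.
under eq_fun do rewrite rV_cons0.
exact: measurable_fst.
Qed.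

Definition rV_uncons {R : realType} d (z : 'rV[R]_d.+1) : R * 'rV[R]_d :=
  (z ord0 ord0, \row_i z ord0 (lift ord0 i)).

Lemma rV_consK (R : realType) d : cancel (@rV_cons R d) (@rV_uncons R d).
Proof.
move=> [x y]; rewrite /rV_uncons rV_cons0; congr pair.
by apply/rowP => i; rewrite mxE rV_consS.
Qed.

Lemma rV_unconsK (R : realType) d : cancel (@rV_uncons R d) (@rV_cons R d).
Proof.
move=> z; apply/rowP => i; case: (unliftP ord0 i) => [j|] ->.
  by rewrite rV_consS mxE.
by rewrite rV_cons0.
Qed.

Lemma measurable_rV_uncons (R : realType) d :
  measurable_fun [set: 'rV[R]_d.+1] (@rV_uncons R d).
Proof.
apply/measurable_fun_pairP; split; first exact: measurable_coord.
apply: measurable_fun_rVP => i /=.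
under eq_fun do rewrite mxE.
exact: measurable_coord.
Qed.

Section lebesgue_rV_step.
Local Open Scope ereal_scope.
Context {R : realType} (d : nat).
Variable mu : {sigma_finite_measure set 'rV[R]_d -> \bar R}.

Definition lebesgue_rV_step : set 'rV[R]_d.+1 -> \bar R :=
  pushforward (@lebesgue_measure R \x mu) (@rV_cons R d).

Let M : {measure set 'rV[R]_d.+1 -> \bar R} :=
  measure_function_pushforward__canonical__measure_function_Measure
    (@lebesgue_measure R \x mu) (@measurable_rV_cons R d).

Let step0 : lebesgue_rV_step set0 = 0.
Proof. exact: (measure0 M). Qed.

Let step_ge0 A : 0 <= lebesgue_rV_step A.
Proof. exact: (measure_ge0 M). Qed.

Let step_sigma_additive : semi_sigma_additive lebesgue_rV_step.
Proof. exact: (@measure_semi_sigma_additive _ _ _ M). Qed.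

HB.instance Definition _ := isMeasure.Build _ _ _ lebesgue_rV_step
  step0 step_ge0 step_sigma_additive.

Let step_sigma_finite : sigma_finite setT lebesgue_rV_step.
Proof.
have [H HT mH] : sigma_finite setT (@lebesgue_measure R \x mu).
  have /sigma_finiteP[F [TF ndF Foo]] := sigma_finiteT (@lebesgue_measure R).
  have /sigma_finiteP[G [TG ndG Goo]] := sigma_finiteT mu.
  exists (fun n => F n `*` G n).
    rewrite -setXTT TF TG predeqE => -[x y]; split.
      move=> [/= [n _ Fnx] [k _ Gky]]; exists (maxn n k) => //; split.
      - by move: x Fnx; exact/subsetPset/ndF/leq_maxl.
      - by move: y Gky; exact/subsetPset/ndG/leq_maxr.
    by move=> [n _ []/= ? ?]; split; exists n.
  move=> k; have [? ?] := Foo k; have [? ?] := Goo k.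
  split; first exact: measurableX.
  by rewrite product_measure1E// lte_mul_pinfty// ge0_fin_numE.
exists (fun i => @rV_uncons R d @^-1` H i).
  by rewrite -preimage_bigcup -HT preimage_setT.
move=> i; have [mHi Hioo] := mH i; split.
  by rewrite -[X in measurable X]setTI; exact: measurable_rV_uncons.
rewrite /lebesgue_rV_step /pushforward -comp_preimage.
by rewrite (_ : _ \o _ = id) ?preimage_id//; apply/funext/rV_consK.
Qed.

HB.instance Definition _ := Measure_isSigmaFinite.Build _ _ _ lebesgue_rV_step
  step_sigma_finite.

End lebesgue_rV_step.

Fixpoint lebesgue_rV_borel {R : realType} d :
    {sigma_finite_measure set 'rV[R]_d -> \bar R} :=
  if d is d'.+1 then lebesgue_rV_step (lebesgue_rV_borel d')
  else \d_(0 : 'rV[R]_0).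

Lemma lebesgue_rV_borel_box (R : realType) d (a b : 'rV[R]_d) :
  (forall i, a ord0 i <= b ord0 i) ->
  lebesgue_rV_borel d
    [set x : 'rV[R]_d | forall i, x ord0 i \in `[a ord0 i, b ord0 i]] =
  (\prod_i (b ord0 i - a ord0 i))%:E.
Proof.
elim: d a b => [|d IH] a b ab.
  by rewrite big_ord0 /= diracE mem_set// => -[].
rewrite big_ord_recl EFinM /=.
pose t (u : 'rV[R]_d.+1) : 'rV[R]_d := \row_i u ord0 (lift ord0 i).
have tE u i : t u ord0 i = u ord0 (lift ord0 i) by rewrite mxE.
pose B : set 'rV[R]_d :=
  [set x : 'rV[R]_d | forall i, x ord0 i \in `[t a ord0 i, t b ord0 i]].
have {IH} : lebesgue_rV_borel d B = (\prod_i (t b ord0 i - t a ord0 i))%:E.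
  by apply: IH => i; rewrite !tE.
under eq_bigr do rewrite !tE.
move=> <-.
transitivity ((@lebesgue_measure R \x lebesgue_rV_borel d)%E
    (`[a ord0 ord0, b ord0 ord0]%classic `*` B)).
  congr ((@lebesgue_measure R \x lebesgue_rV_borel d)%E _); apply/seteqP.
  split=> [[x y] /= H|[x y] /= [Hx Hy] i].
    split; first by have := H ord0; rewrite rV_cons0.
    by move=> i; have := H (lift ord0 i); rewrite rV_consS !tE.
  case: (unliftP ord0 i) => [j|] ->; last by rewrite rV_cons0.
  by rewrite rV_consS; have := Hy j; rewrite !tE.
rewrite product_measure1E//.
  congr (_ * _)%E; have /= := @lebesgue_measure_itv R `[a ord0 ord0, b ord0 ord0].
  by rewrite lte_fin => ->; case: ltgtP (ab ord0) => // -> _; rewrite subrr.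
rewrite (_ : B = \bigcap_(i in [set: 'I_d])
    ((fun x : 'rV[R]_d => x ord0 i : R) @^-1`
       `[t a ord0 i, t b ord0 i]%classic)); last first.
  by apply/seteqP; split=> x H i; [move=> _; exact: H|exact: (H i I)].
apply: fin_bigcap_measurable => [|i _]; first exact: finite_finset.
rewrite -[X in measurable X]setTI; exact: measurable_coord.
Qed.

(* The completion makes Lebesgue measurable, not only Borel measurable, weights
   admissible as integrands. *)
Definition lebesgue_rV {R : realType} (d : nat) :=
  @completed_measure_extension _ _ R (@lebesgue_rV_borel R d).

HB.instance Definition _ {R : realType} d := Measure.on (@lebesgue_rV R d).

Notation lebesgue_rVType R d :=
  (caratheodory_type (mu_ext (@lebesgue_rV_borel R d))).

Section kernels.
Context {R : realType} {d : nat}.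
Implicit Type k : 'rV[R]_d -> 'rV[R]_d -> R.

Definition gram k N (x : 'I_N -> 'rV[R]_d) : 'M[R]_N :=
  \matrix_(a, b) k (x a) (x b).

Definition kernel_symmetric k := forall p p', k p p' = k p' p.

Definition translation_invariant k :=
  forall a p p', k (p + a) (p' + a) = k p p'.

(* Strict definiteness: the Gram matrix of distinct points is invertible. *)
Definition positive_definite k := forall N (x : 'I_N -> 'rV[R]_d) (c : 'cV[R]_N),
  injective x -> c != 0 -> 0 < (c^T *m gram k x *m c) ord0 ord0.

Definition covariance_kernel k :=
  [/\ continuous (fun pp : 'rV[R]_d * 'rV[R]_d => k pp.1 pp.2),
      kernel_symmetric k, translation_invariant k & positive_definite k].

Definition strictly_positive k := forall p p', 0 < k p p'.

End kernels.

Section posterior.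
Context {R : realType} {d N : nat}.
Variables (pts : 'I_N -> 'rV[R]_d) (v : 'rV[R]_N).

(* The family (pts, p), with p in the last position. *)
Definition add_point (p : 'rV[R]_d) (a : 'I_(N + 1)) : 'rV[R]_d :=
  match fintype.split a with inl i => pts i | inr _ => p end.

(* [K^-1 + V]^-1, read as (1 + K V)^-1 K when K is singular. *)
Definition posterior_cov (K V : 'M[R]_(N + 1)) : 'M[R]_(N + 1) :=
  if K \in unitmx then invmx (invmx K + V) else invmx (1%:M + K *m V) *m K.

Definition posterior_var (k : 'rV[R]_d -> 'rV[R]_d -> R) (p : 'rV[R]_d) : R :=
  let e : 'cV[R]_(N + 1) := delta_mx (rshift N ord0) ord0 in
  let K := gram k (add_point p) in
  let V := diag_mx (row_mx v 0) in
  (e^T *m posterior_cov K V *m e) ord0 ord0.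

Definition posterior_sd m (k : 'I_m -> 'rV[R]_d -> 'rV[R]_d -> R)
    (p : 'rV[R]_d) : 'M[R]_m :=
  diag_mx (\row_c Num.sqrt (posterior_var (k c) p)).

End posterior.

Definition euclidean_norm {R : realType} m (x : 'cV[R]_m) : R :=
  Num.sqrt (\sum_i x i ord0 ^+ 2).

Definition spectral_norm {R : realType} m (A : 'M[R]_m) : R :=
  sup [set euclidean_norm (A *m x) | x in [set x | euclidean_norm x <= 1]].

(* Real power of a nonnegative diagonal matrix. *)
Definition diag_powR {R : realType} m (A : 'M[R]_m) (q : R) : 'M[R]_m :=
  diag_mx (\row_c (A c c `^ q)).

Variant error_model := SpectralError | TraceError.

(* The q-th power of the error bound, as a function of sigma = sigma_v(p). *)
Definition error_pow {R : realType} (em : error_model) (q : R) m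
    (sigma : 'M[R]_m) : R :=
  match em with
  | SpectralError =>
      (m%:R * (1 - 2 / (9 * m%:R)) ^+ 3) `^ (q / 2) * spectral_norm sigma `^ q
  | TraceError => \tr (diag_powR sigma q)
  end.

Definition total_error {R : realType} (em : error_model) (q : R) d N m
    (X : set 'rV[R]_d) (w : 'rV[R]_d -> R) (pts : 'I_N -> 'rV[R]_d)
    (k : 'I_m -> 'rV[R]_d -> 'rV[R]_d -> R) (v : 'rV[R]_N) : R :=
  (\int[@lebesgue_rV R d]_(p in X)
     (w p `^ q * error_pow em q (posterior_sd pts v k p))) `^ q^-1.

Definition work {R : realType} (s : R) N (v : 'rV[R]_N) : R :=
  \sum_i v ord0 i `^ s.

Definition work_of_tolerances {R : realType} (s : R) n (eps : 'I_n -> R) : R :=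
  \sum_i eps i `^ (- (2 * s)).

Definition lower_bound {R : realType} n j (eps : 'I_n -> R) : 'rV[R]_(n + j) :=
  row_mx (\row_i eps i ^- 2) 0.

Definition nonneg_orthant {R : realType} N : set 'rV[R]_N :=
  [set v | forall i, 0 <= v ord0 i].

Definition admissible {R : realType} (s DW : R) n j (eps : 'I_n -> R) :
    set 'rV[R]_(n + j) :=
  [set v | [/\ nonneg_orthant v,
      (forall i, lower_bound j eps ord0 i <= v ord0 i) &
      work s v <= DW + work_of_tolerances s eps]].

Definition is_minimizer {R : realType} (T : Type) (A : set T) (E : T -> R)
    (v : T) := A v /\ forall u, A u -> E v <= E u.

(* Main.v *)
(* With A the inverse Gram matrix of the design points, b = A k(., p) and S >= 0
   the Schur complement of the Gram matrix of the points and p, the posterior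
   variance is S + b^T (A + diag v)^-1 b, also when p is a design point.  Writing
   h_v = (A + diag v)^-1 b and expanding the quadratic form of A + diag u at
   h_u - a h_v gives
     0 <= var u - 2 a var v + a^2 (var v + sum_i (u_i - v_i) h_v,i^2)
   for every a.  Optimising over a and using the tangent of x |-> 1 / sqrt x, the
   standard deviation itself (not only the variance) is convex in v, so the error
   is an L^q norm of a convex function and Minkowski applies.  It is also
   Lipschitz in v, and a minimiser exists by compactness.

   Uniqueness: let u <> v be minimisers, x their midpoint, and i an index where
   they differ.  With a = 1 the inequality above is strict unless
   (u_l - v_l) h_v,l = 0 for all l, so at a point p where the integrand has no
   midpoint gap, h_x,i(p) = 0 for every component that realises the error.  Then
   lowering x_i is free at first order at p, and spending the freed budget on the
   other coordinates strictly helps because k(., p) <> 0.  The monotone difference quotients in that direction carry this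
   from points to the integral. *)

Require Import Defs.
From HB Require Import structures.
From mathcomp Require Import all_boot all_order all_algebra.
From mathcomp Require Import all_classical all_reals all_analysis.
From mathcomp Require Import measurable_realfun ring lra.

Set Implicit Arguments.
Unset Strict Implicit.
Unset Printing Implicit Defensive.

Import Order.TTheory GRing.Theory Num.Theory.
Import numFieldNormedType.Exports.

Local Open Scope classical_set_scope.
Local Open Scope ring_scope.

(** * Quadratic forms and resolvents *)

Section quadratic_forms.
Context {R : realType} {N : nat}.
Implicit Types (M : 'M[R]_N) (x y : 'cV[R]_N) (v : 'rV[R]_N).

Definition bform M x y : R := (x^T *m M *m y) ord0 ord0.

Definition posdef M := forall x, x != 0 -> 0 < bform M x x.

Lemma bformC M x y : M^T = M -> bform M x y = bform M y x.
Proof.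
move=> sM; rewrite /bform -[in LHS](trmxK (x^T *m M *m y)) mxE.
by rewrite !trmx_mul trmxK sM mulmxA.
Qed.

Lemma bformBZ M x y a : M^T = M ->
  bform M (x - a *: y) (x - a *: y) =
  bform M x x - 2 * a * bform M x y + a ^+ 2 * bform M y y.
Proof.
move=> sM; have := bformC y x sM; rewrite /bform => yx.
have -> : (x - a *: y)^T = x^T - a *: y^T by apply/matrixP => i j; rewrite !mxE.
rewrite mulmxBl mulmxBr mulmxBl mulmxBl -!scalemxAl.
rewrite -!scalemxAr !mxE; move: yx; rewrite !mxE => ->; ring.
Qed.

Lemma bform_diag M v x y :
  bform (M + diag_mx v) x y =
  bform M x y + \sum_i v ord0 i * (x i ord0 * y i ord0).
Proof.
rewrite /bform mulmxDr mulmxDl mxE; congr (_ + _).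
rewrite mxE; apply: eq_bigr => i _.
by rewrite mul_mx_diag !mxE; ring.
Qed.

Lemma posdef_ge0 M x : posdef M -> 0 <= bform M x x.
Proof.
move=> pM; have [->|/pM/ltW//] := eqVneq x 0.
by rewrite /bform mulmx0 mxE.
Qed.

Lemma posdef_eq0 M x : posdef M -> bform M x x <= 0 -> x = 0.
Proof. by move=> pM; apply: contraTeq => /pM; rewrite -ltNge. Qed.

Lemma posdef_unitmx M : posdef M -> M \in unitmx.
Proof.
move=> pM; rewrite -row_free_unit -kermx_eq0; apply/negPn/negP.
move=> /rowV0Pn[x /sub_kermxP xM x0].
have /pM : x^T != 0 by rewrite trmx_eq0.
by rewrite /bform trmxK xM mul0mx mxE ltxx.
Qed.

Lemma posdef_inv M : M^T = M -> posdef M -> posdef (invmx M).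
Proof.
move=> sM pM x x0; have uM := posdef_unitmx pM.
have : invmx M *m x != 0.
  by apply: contra_neq x0 => e; rewrite -(mulKVmx uM x) e mulmx0.
move=> /pM; rewrite /bform trmx_mul trmx_inv sM -!mulmxA.
by rewrite (mulKVmx uM).
Qed.

Lemma posdefD_diag M v : posdef M -> nonneg_orthant v ->
  posdef (M + diag_mx v).
Proof.
move=> pM v0 x /pM Mx; rewrite bform_diag ltr_pwDl// sumr_ge0// => i _.
by rewrite mulr_ge0// -expr2 sqr_ge0.
Qed.

End quadratic_forms.

Lemma diag_mx_mulE (R : pzRingType) N (v : 'rV[R]_N) (x : 'cV[R]_N) i :
  (diag_mx v *m x) i ord0 = v ord0 i * x i ord0.
Proof. by rewrite mul_diag_mx mxE. Qed.

(** * Resolvent forms S + b^T (A + diag v)^-1 b *)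

Section resolvent_form.
Context {R : realType} {N : nat}.
Variables (A : 'M[R]_N) (b : 'cV[R]_N) (S : R).
Hypotheses (sA : A^T = A) (pA : posdef A) (S_ge0 : 0 <= S).
Implicit Types u v : 'rV[R]_N.

Definition resol v : 'cV[R]_N := invmx (A + diag_mx v) *m b.

Definition rform v : R := S + (b^T *m resol v) ord0 ord0.

Let M v := A + diag_mx v.

Let symM v : (M v)^T = M v.
Proof. by rewrite /M linearD /= tr_diag_mx sA. Qed.

Let unitM v : nonneg_orthant v -> M v \in unitmx.
Proof. by move=> v0; apply/posdef_unitmx/posdefD_diag. Qed.

Let M_resol v : nonneg_orthant v -> M v *m resol v = b.
Proof. by move=> v0; rewrite mulKVmx// unitM. Qed.

Let bform_resol v x : nonneg_orthant v ->
  bform (M v) (resol v) x = (b^T *m x) ord0 ord0.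
Proof.
by move=> v0; rewrite /bform -[in LHS]symM -trmx_mul M_resol.
Qed.

Lemma rformE v : nonneg_orthant v -> rform v = S + bform (M v) (resol v) (resol v).
Proof. by move=> v0; rewrite bform_resol. Qed.

(** The forms of [M u] and [M v] differ only on the diagonal. The left side is visibly nonnegative,
    which the right side does not show. *)
Lemma rform_shift u v : nonneg_orthant v ->
  S + bform (M u) (resol v) (resol v) =
  rform v + \sum_i (u ord0 i - v ord0 i) * resol v i ord0 ^+ 2.
Proof.
move=> v0; rewrite rformE// /M !bform_diag -!addrA; congr (_ + (_ + _)).
by rewrite -big_split; apply: eq_bigr => i _; rewrite /=; ring.
Qed.

Lemma rform_expand u v a : nonneg_orthant u -> nonneg_orthant v ->
  S * (1 - a) ^+ 2 + bform (M u) (resol u - a *: resol v) (resol u - a *: resol v)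
  = rform u - 2 * a * rform v + a ^+ 2 *
    (rform v + \sum_i (u ord0 i - v ord0 i) * resol v i ord0 ^+ 2).
Proof.
move=> u0 v0; rewrite bformBZ// -rform_shift// !bform_resol//.
rewrite /rform; ring.
Qed.

(** By [rform_expand], rform u - 2 a rform v + a^2 L is nonnegative for every a, where L is the
    second factor on the right; the claim is that its discriminant is not positive. This squared
    tangent inequality is what later yields convexity of the square root. *)
Lemma rform_sqr_le u v : nonneg_orthant u -> nonneg_orthant v ->
  rform v ^+ 2 <= rform u *
    (rform v + \sum_i (u ord0 i - v ord0 i) * resol v i ord0 ^+ 2).
Proof.
move=> u0 v0; set L := (X in _ * X).
have H a : 0 <= rform u - 2 * a * rform v + a ^+ 2 * L.
  rewrite /L -rform_expand//; apply: addr_ge0; first by rewrite mulr_ge0// sqr_ge0.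
  exact/posdef_ge0/posdefD_diag.
have L0 : 0 <= L.
  rewrite /L -rform_shift// addr_ge0//; exact/posdef_ge0/posdefD_diag.
(* For L = 0 the polynomial is affine in a, so its slope must vanish: otherwise the value of a
   tested below gives -1. *)
have := L0; rewrite le_eqVlt => /predU1P[L0'|Lp].
  rewrite -L0' mulr0.
  have [->|v_neq0] := eqVneq (rform v) 0; first by rewrite expr0n.
  have := H ((rform u + 1) / (2 * rform v)); rewrite -L0' mulr0 addr0.
  have -> : 2 * ((rform u + 1) / (2 * rform v)) * rform v = rform u + 1.
    by field.
  lra.
(* The minimiser of the quadratic. *)
have := H (rform v / L); move/(mulr_ge0 L0).
have -> : L * (rform u - 2 * (rform v / L) * rform v + (rform v / L) ^+ 2 * L) =
  rform u * L - rform v ^+ 2 by field; rewrite gt_eqF.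
by rewrite subr_ge0.
Qed.

(** The partial derivatives of [rform] at v are -h_i^2 with h = [resol v], so this is the tangent
    inequality of a convex function. At a = 1 the S term of [rform_expand] drops out. *)
Lemma rform_tangent u v : nonneg_orthant u -> nonneg_orthant v ->
  rform v <= rform u + \sum_i (u ord0 i - v ord0 i) * resol v i ord0 ^+ 2.
Proof.
move=> u0 v0; have := rform_expand 1 u0 v0.
rewrite subrr expr0n mulr0 add0r scale1r => e.
have : 0 <= bform (M u) (resol u - resol v) (resol u - resol v).
  exact/posdef_ge0/posdefD_diag.
by rewrite e; lra.
Qed.

Let resol_uniq u x : nonneg_orthant u -> M u *m x = b -> x = resol u.
Proof. by move=> u0 e; rewrite /resol -e mulKmx// unitM. Qed.

(** The two diagonals act alike on [resol v], which therefore solves both linear systems. *)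
Lemma resol_eq u v : nonneg_orthant u -> nonneg_orthant v ->
  (forall i, (u ord0 i - v ord0 i) * resol v i ord0 = 0) -> resol u = resol v.
Proof.
move=> u0 v0 e; apply/esym/resol_uniq => //.
rewrite -[RHS](M_resol v0) /M !mulmxDl; congr (_ + _).
apply/matrixP => i j; rewrite (ord1 j) !diag_mx_mulE.
by apply/eqP; rewrite -subr_eq0 -mulrBl e.
Qed.

Lemma rform_eq u v : nonneg_orthant u -> nonneg_orthant v ->
  (forall i, (u ord0 i - v ord0 i) * resol v i ord0 = 0) -> rform u = rform v.
Proof. by move=> u0 v0 e; rewrite /rform (resol_eq u0 v0 e). Qed.

(** Equality in [rform_tangent] makes the form of [M u] vanish at resol u - resol v, so both systems
    have the same solution; subtracting them leaves the diagonal terms. *)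
Lemma rform_tangent_eq u v : nonneg_orthant u -> nonneg_orthant v ->
  rform u + \sum_i (u ord0 i - v ord0 i) * resol v i ord0 ^+ 2 <= rform v ->
  forall i, (u ord0 i - v ord0 i) * resol v i ord0 = 0.
Proof.
move=> u0 v0 le_uv.
have e : resol u = resol v.
  apply/eqP; rewrite -subr_eq0; apply/eqP/(posdef_eq0 (posdefD_diag pA u0)).
  have := rform_expand 1 u0 v0.
  rewrite subrr expr0n mulr0 add0r scale1r => ->; lra.
move=> i; have : (M u *m resol v) i ord0 = (M v *m resol v) i ord0.
  by rewrite -{1}e !M_resol.
rewrite /M !mulmxDl ![(_ + _ : 'cV_N) i _]mxE => /addrI.
rewrite !diag_mx_mulE => uv.
by rewrite mulrBl uv subrr.
Qed.

Lemma resol_eq0 v : nonneg_orthant v -> resol v = 0 -> b = 0.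
Proof. by move=> v0 e; rewrite -(M_resol v0) e mulmx0. Qed.

Lemma rform_eq0 v : nonneg_orthant v -> rform v <= 0 -> b = 0 /\ S = 0.
Proof.
move=> v0; rewrite rformE//.
have h0 : 0 <= bform (M v) (resol v) (resol v).
  exact/posdef_ge0/posdefD_diag.
move=> le0; split; last first.
  apply/eqP; rewrite eq_le S_ge0 andbT.
  by move: le0; apply: le_trans; rewrite lerDl.
apply/(resol_eq0 v0)/(posdef_eq0 (posdefD_diag pA v0)).
by move: le0; apply: le_trans; rewrite lerDr.
Qed.

Lemma rform_antitone u v : nonneg_orthant u ->
  (forall i, u ord0 i <= v ord0 i) -> rform v <= rform u.
Proof.
move=> u0 uv; have v0 : nonneg_orthant v.
  by move=> i; rewrite (le_trans (u0 i)).
apply: (le_trans (rform_tangent u0 v0)); rewrite gerDl.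
by apply: sumr_le0 => i _; rewrite mulr_le0_ge0 ?sqr_ge0// subr_le0.
Qed.

(* At the larger point the resolvent is not supported on the unmoved
   coordinates, since otherwise it would coincide with [resol u]. *)
Lemma rform_lt u v i : nonneg_orthant u -> b != 0 -> resol u i ord0 = 0 ->
  v ord0 i = u ord0 i -> (forall l, l != i -> u ord0 l < v ord0 l) ->
  rform v < rform u.
Proof.
move=> u0 b0 hi vi uv.
have v0 : nonneg_orthant v.
  move=> l; have [->|/uv/ltW] := eqVneq l i; first by rewrite vi.
  exact/le_trans.
rewrite ltNge; apply/negP => le_uv.
have le0 l : (u ord0 l - v ord0 l) * resol v l ord0 ^+ 2 <= 0.
  have [->|/uv] := eqVneq l i; first by rewrite vi subrr mul0r.
  by move=> uvl; rewrite mulr_le0_ge0 ?sqr_ge0// subr_le0 ltW.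
have sum0 : \sum_l (u ord0 l - v ord0 l) * resol v l ord0 ^+ 2 = 0.
  apply/eqP; rewrite eq_le sumr_le0//=.
  by have := rform_tangent u0 v0; lra.
have e l : (u ord0 l - v ord0 l) * resol v l ord0 = 0.
  apply: (rform_tangent_eq u0 v0); rewrite sum0; lra.
have huv := resol_eq u0 v0 e.
move/eqP: b0; apply; apply: (resol_eq0 u0).
apply/matrixP => l z; rewrite (ord1 z) [RHS]mxE.
have [->//|/uv uvl] := eqVneq l i.
apply/eqP; have /eqP := e l; rewrite -huv mulf_eq0 => /orP[|//].
by rewrite subr_eq0 (lt_eqF uvl).
Qed.

End resolvent_form.

(* Tangent bound for x |-> 1 / sqrt x at r ^+ 2, evaluated at r ^+ 2 + L. *)
Lemma sqrt_tangent (R : realType) (r s L : R) : 0 < r -> 0 <= s ->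
  (r ^+ 2) ^+ 2 <= s ^+ 2 * (r ^+ 2 + L) -> 2 * r ^+ 2 <= 2 * r * s + L.
Proof.
move=> r0 s0 H.
have l0 : 0 < r ^+ 2 + L.
  have r4 : 0 < (r ^+ 2) ^+ 2 by rewrite !exprn_gt0.
  have := lt_le_trans r4 H; rewrite pmulr_rgt0//.
  rewrite lt_neqAle sqr_ge0 andbT eq_sym; apply: contraTneq H => ->.
  by rewrite mul0r -ltNge.
rewrite leNgt; apply/negP => lt_rs.
(* The claim reads 3 r^2 - l <= 2 r s. If it failed, squaring would give 4 r^2 s^2 l < (3 r^2 - l)^2
   l. But the right side is at most 4 r^6, by the factorisation below, and 4 r^6 <= 4 r^2 s^2 l by
   hypothesis. *)
pose l := r ^+ 2 + L.
have rs0 : 0 <= 2 * r * s by rewrite !mulr_ge0// ltW.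
have y0 : 2 * r * s < 3 * r ^+ 2 - l by rewrite /l; lra.
have l3 : 0 <= 4 * r ^+ 2 - l by have := sqr_ge0 r; lra.
have lt1 : (2 * r * s) ^+ 2 * l < (3 * r ^+ 2 - l) ^+ 2 * l.
  by rewrite ltr_pM2r// ltr_pXn2r// nnegrE (le_trans rs0)// ltW.
have le1 : 4 * r ^+ 2 * (r ^+ 2) ^+ 2 <= 4 * r ^+ 2 * (s ^+ 2 * l).
  by rewrite ler_wpM2l// mulr_ge0// sqr_ge0.
have : (3 * r ^+ 2 - l) ^+ 2 * l <= 4 * r ^+ 2 * (r ^+ 2) ^+ 2.
  rewrite -subr_ge0.
  have -> : 4 * r ^+ 2 * (r ^+ 2) ^+ 2 - (3 * r ^+ 2 - l) ^+ 2 * l =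
    (l - r ^+ 2) ^+ 2 * (4 * r ^+ 2 - l) by ring.
  by rewrite mulr_ge0// sqr_ge0.
move=> /(lt_le_trans lt1)/lt_le_trans/(_ le1).
have -> : (2 * r * s) ^+ 2 * l = 4 * r ^+ 2 * (s ^+ 2 * l) by ring.
by rewrite ltxx.
Qed.

(** Cauchy-Schwarz for the form of A: the vector K e_i represents the i-th coordinate and has
    squared norm K_ii. The bound makes the variance Lipschitz in v, uniformly in p. *)
Lemma resol_sqr_le (R : realType) N (A K : 'M[R]_N) (b : 'cV[R]_N) (S : R)
    (v : 'rV[R]_N) i : A^T = A -> posdef A -> 0 <= S -> A *m K = 1%:M ->
  nonneg_orthant v -> 0 < K i i ->
  resol A b v i ord0 ^+ 2 <= K i i * rform A b S v.
Proof.
move=> sA pA S0 AK v0 Ki; set h := resol A b v.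
pose x : 'cV[R]_N := K *m delta_mx i ord0.
have bx (y : 'cV[R]_N) : bform A y x = y i ord0.
  by rewrite /bform /x -!mulmxA (mulmxA A) AK mul1mx -colE !mxE.
have xi : x i ord0 = K i i by rewrite /x -colE mxE.
have := posdef_ge0 (h - (h i ord0 / K i i) *: x) pA.
rewrite bformBZ// !bx xi.
have -> : bform A h h - 2 * (h i ord0 / K i i) * h i ord0 +
  (h i ord0 / K i i) ^+ 2 * K i i = bform A h h - h i ord0 ^+ 2 / K i i.
  by field; rewrite gt_eqF.
rewrite subr_ge0 ler_pdivrMr// mulrC => /le_trans; apply.
rewrite ler_pM2l// rformE// bform_diag addrCA lerDl addr_ge0// sumr_ge0// => l _.
by rewrite mulr_ge0// -expr2 sqr_ge0.
Qed.

Lemma split_rshift_inj m n (i : 'I_n) : fintype.split (rshift m i) = inr i.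
Proof. exact: (unsplitK (inr i)). Qed.

Lemma split_lshift_inj m n (i : 'I_m) : fintype.split (lshift n i) = inl i.
Proof. exact: (unsplitK (inl i)). Qed.

(** * The posterior variance *)

Section posterior_variance.
Context {R : realType} {d N : nat}.
Variables (pts : 'I_N -> 'rV[R]_d) (k : 'rV[R]_d -> 'rV[R]_d -> R).
Hypotheses (pts_inj : injective pts) (k_cov : covariance_kernel k).
Implicit Types (u v : 'rV[R]_N) (p : 'rV[R]_d).

Definition cross_cov p : 'cV[R]_N := \col_i k (pts i) p.

Definition prec : 'M[R]_N := invmx (gram k pts).

Definition schur p : R := k p p - (bform prec (cross_cov p) (cross_cov p)).

Let pd := let: And4 _ _ _ pd := k_cov in pd.
Let ksym := let: And4 _ s _ _ := k_cov in s.
Let ktr := let: And4 _ _ t _ := k_cov in t.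

Lemma kernel_diag p : k p p = k 0 0.
Proof. by rewrite -(ktr p 0 0) add0r. Qed.

Lemma gram_sym n (x : 'I_n -> 'rV[R]_d) : (gram k x)^T = gram k x.
Proof. by apply/matrixP => i j; rewrite !mxE ksym. Qed.

Lemma gram_posdef n (x : 'I_n -> 'rV[R]_d) : injective x -> posdef (gram k x).
Proof. by move=> xi c; exact: pd. Qed.

Lemma kernel_diag_gt0 : 0 < k 0 0.
Proof.
have inj : injective (fun _ : 'I_1 => 0 : 'rV[R]_d) by move=> i j; rewrite !ord1.
have := @pd 1 (fun=> 0) 1%:M inj (oner_neq0 _).
by rewrite trmx1 mul1mx mulmx1 mxE.
Qed.

Let gram_unit : gram k pts \in unitmx.
Proof. exact/posdef_unitmx/gram_posdef. Qed.

Lemma prec_sym : prec^T = prec.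
Proof. by rewrite trmx_inv gram_sym. Qed.

Lemma prec_posdef : posdef prec.
Proof. by apply: posdef_inv; [exact: gram_sym|exact: gram_posdef]. Qed.

Lemma add_pointl p i : add_point pts p (lshift 1 i) = pts i.
Proof. by rewrite /add_point split_lshift_inj. Qed.

Lemma add_pointr p i : add_point pts p (rshift N i) = p.
Proof. by rewrite /add_point split_rshift_inj. Qed.

Lemma gram_add_point p : gram k (add_point pts p) =
  block_mx (gram k pts) (cross_cov p) (cross_cov p)^T (k p p)%:M.
Proof.
apply/matrixP => i j; case: (split_ordP i) => i' ->; case: (split_ordP j) => j' ->.
- by rewrite block_mxEul !mxE !add_pointl.
- by rewrite block_mxEur !mxE add_pointl add_pointr.
- by rewrite block_mxEdl !mxE add_pointl add_pointr ksym.
- by rewrite block_mxEdr !mxE !add_pointr !ord1 mulr1n.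
Qed.

(** At a design point the cross-covariance is a column of the Gram matrix and the complement is 0.
    Elsewhere the enlarged family is still injective, and its positive definite Gram form at (- prec
    k_p, 1) equals the complement. *)
Lemma schur_ge0 p : 0 <= schur p.
Proof.
have [[i pi]|npts] := pselect (exists i, pts i = p).
  have kE : cross_cov p = gram k pts *m delta_mx i ord0.
    by apply/matrixP => a b; rewrite -colE !mxE pi.
  rewrite /schur /bform -mulmxA {2}kE mulKmx// -colE !mxE -pi.
  by rewrite subrr.
have inj : injective (add_point pts p).
  move=> a b; case: (split_ordP a) => a' ->; case: (split_ordP b) => b' ->;
    rewrite ?(add_pointl, add_pointr).
  - by move=> /pts_inj ->.
  - by move=> e; case: npts; exists a'.
  - by move=> e; case: npts; exists b'.
  - by rewrite !ord1.
pose c : 'cV[R]_(N + 1) := col_mx (- (prec *m cross_cov p)) 1%:M.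
have c0 : c != 0.
  apply/eqP => /matrixP /(_ (rshift N ord0) ord0).
  rewrite col_mxEd !mxE => /eqP; by rewrite oner_eq0.
have /ltW := gram_posdef inj c0.
rewrite /bform gram_add_point /c tr_col_mx -mulmxA mul_block_col.
rewrite mul_row_col trmx1 mul1mx !mulmx1 mulmxN mulmxA mulmxV// mul1mx addNr.
rewrite mulmx0 add0r mulmxN mulmxA.
rewrite mxE [X in _ + X]mxE [X in X + _]mxE eqxx mulr1n addrC.
by [].
Qed.

Definition post_cov v p : 'cV[R]_N := resol prec (prec *m cross_cov p) v.

Lemma posterior_varE v p : nonneg_orthant v ->
  posterior_var pts v k p = rform prec (prec *m cross_cov p) (schur p) v.
Proof.
move=> v0; have [h hE] : exists h, h = post_cov v p by exists (post_cov v p).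
set K0 := gram k pts; set kp := cross_cov p.
set s := rform _ _ _ _.
pose K := gram k (add_point pts p); pose V : 'M[R]_(N + 1) := diag_mx (row_mx v 0).
have uM : prec + diag_mx v \in unitmx.
  exact/posdef_unitmx/posdefD_diag/v0/prec_posdef.
have K0M : K0 *m (prec + diag_mx v) = 1%:M + K0 *m diag_mx v.
  by rewrite mulmxDr /prec mulmxV.
(* The last diagonal entry of V is 0, so 1 + K V is block lower triangular and invertible as soon as
   its upper left block is. *)
have KVE : 1%:M + K *m V =
    block_mx (1%:M + K0 *m diag_mx v) 0 (kp^T *m diag_mx v) 1%:M.
  rewrite /K /V gram_add_point diag_mx_row mulmx_block.
  have -> : diag_mx 0 = 0 :> 'M[R]_1 by apply/matrixP => a z; rewrite !mxE mul0rn.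
  by rewrite !mulmx0 !addr0 scalar_mx_block add_block_mx !addr0 add0r.
have uKV : 1%:M + K *m V \in unitmx.
  rewrite KVE unitmxE det_lblock det1 mulr1 -unitmxE -K0M unitmx_mul uM andbT.
  exact: gram_unit.
(* Both branches of [posterior_cov] solve this equation, so from here on singular and regular K are
   treated alike. *)
have CE : (1%:M + K *m V) *m posterior_cov K V = K.
  rewrite /posterior_cov; case: ifPn => uK; last by rewrite mulmxA mulmxV// mul1mx.
  have -> : invmx K + V = invmx K *m (1%:M + K *m V).
    by rewrite mulmxDr mulmx1 mulKmx.
  have uW : invmx K *m (1%:M + K *m V) \in unitmx.
    by rewrite unitmx_mul unitmx_inv uK.
  have /(congr1 (mulmx K)) := mulmxV uW.
  by rewrite mulmxA mulKVmx// mulmx1.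
have Mh : prec *m h + diag_mx v *m h = prec *m kp.
  by rewrite -mulmxDl hE /post_cov /resol mulKVmx.
have sE : (kp^T *m (diag_mx v *m h)) ord0 ord0 + s = k p p.
  move/(canRL (addKr _)) : Mh => ->.
  rewrite mulmxDr mulmxN !mulmxA mxE [X in X + _ + _]mxE.
  rewrite /s /rform /schur /bform trmx_mul prec_sym -/kp -/(post_cov v p) -hE.
  ring.
pose e : 'cV[R]_(N + 1) := delta_mx (rshift N ord0) ord0.
pose x : 'cV[R]_(N + 1) := col_mx h s%:M.
(* The last column of the posterior covariance is (h, s): apply the invertible 1 + K V and compare
   blockwise with the last column of K. *)
have Ce : posterior_cov K V *m e = x.
  apply: (can_inj (mulKmx uKV)); rewrite mulmxA CE KVE mul_block_col -colE.
  rewrite mul0mx addr0 mulmxDl mul1mx -!mulmxA; apply/matrixP => a z.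
  rewrite (ord1 z) mxE; case: (split_ordP a) => a' ->.
    rewrite col_mxEu /K gram_add_point block_mxEur.
    have /matrixP /(_ a' ord0) : h + K0 *m (diag_mx v *m h) = kp.
      rewrite -{1}(mulKVmx gram_unit h) -/prec -/K0 -mulmxDr Mh.
      exact: mulKVmx.
    by move=> <-.
  rewrite (ord1 a') col_mxEd /K gram_add_point block_mxEdr.
  by rewrite mul1mx [LHS]mxE [RHS]mxE [X in _ = _ + X]mxE eqxx mulr1n -sE.
rewrite /posterior_var -/K -/V -/e -mulmxA Ce /e trmx_delta -rowE.
by rewrite mxE col_mxEd mxE mulr1n.
Qed.

Local Notation pvar v p := (posterior_var pts v k p).

Lemma posterior_var_sqr_le u v p : nonneg_orthant u -> nonneg_orthant v ->
  pvar v p ^+ 2 <= pvar u p *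
    (pvar v p + \sum_i (u ord0 i - v ord0 i) * post_cov v p i ord0 ^+ 2).
Proof.
move=> u0 v0; rewrite !posterior_varE//.
exact: (rform_sqr_le _ prec_sym prec_posdef (schur_ge0 p) u0 v0).
Qed.

Lemma posterior_var_tangent u v p : nonneg_orthant u -> nonneg_orthant v ->
  pvar v p <=
  pvar u p + \sum_i (u ord0 i - v ord0 i) * post_cov v p i ord0 ^+ 2.
Proof.
move=> u0 v0; rewrite !posterior_varE//.
exact: (rform_tangent _ _ prec_sym prec_posdef u0 v0).
Qed.

Lemma posterior_var_tangent_eq u v p : nonneg_orthant u -> nonneg_orthant v ->
  pvar u p + \sum_i (u ord0 i - v ord0 i) * post_cov v p i ord0 ^+ 2 <= pvar v p ->
  forall i, (u ord0 i - v ord0 i) * post_cov v p i ord0 = 0.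
Proof.
move=> u0 v0; rewrite !posterior_varE//.
exact: (rform_tangent_eq prec_sym prec_posdef u0 v0).
Qed.

Lemma posterior_var_eq u v p : nonneg_orthant u -> nonneg_orthant v ->
  (forall i, (u ord0 i - v ord0 i) * post_cov v p i ord0 = 0) ->
  pvar u p = pvar v p /\ post_cov u p = post_cov v p.
Proof.
move=> u0 v0 e; rewrite !posterior_varE//; split.
  exact: (rform_eq _ prec_posdef u0 v0).
exact: (resol_eq prec_posdef u0 v0).
Qed.

(** A zero variance would force both the cross-covariance and the Schur complement to vanish, but
    without cross-covariance the complement is the prior variance k 0 0 > 0. *)
Lemma posterior_var_gt0 v p : nonneg_orthant v -> 0 < pvar v p.
Proof.
move=> v0; rewrite posterior_varE// ltNge; apply/negP.
move=> /(rform_eq0 prec_sym prec_posdef (schur_ge0 p) v0)[b0].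
have kp0 : cross_cov p = 0 by rewrite -(mulKVmx gram_unit (cross_cov p)) b0 mulmx0.
rewrite /schur kp0 /bform mulmx0 mxE subr0 kernel_diag.
by move/eqP; rewrite gt_eqF// kernel_diag_gt0.
Qed.

Lemma posterior_var_antitone u v p : nonneg_orthant u ->
  (forall i, u ord0 i <= v ord0 i) -> pvar v p <= pvar u p.
Proof.
move=> u0 uv; have v0 : nonneg_orthant v.
  by move=> i; rewrite (le_trans (u0 i)).
rewrite !posterior_varE//; exact: (rform_antitone _ _ prec_sym prec_posdef).
Qed.

Lemma posterior_var_lt u v p i : nonneg_orthant u -> 0 < k (pts i) p ->
  post_cov u p i ord0 = 0 -> v ord0 i = u ord0 i ->
  (forall l, l != i -> u ord0 l < v ord0 l) -> pvar v p < pvar u p.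
Proof.
move=> u0 kp hi vi uv; have v0 : nonneg_orthant v.
  move=> l; have [->|/uv/ltW] := eqVneq l i; first by rewrite vi.
  exact/le_trans.
rewrite !posterior_varE//.
apply: (rform_lt _ prec_sym prec_posdef u0 _ hi vi uv).
apply/eqP => b0.
have kp0 : cross_cov p = 0 by rewrite -(mulKVmx gram_unit (cross_cov p)) b0 mulmx0.
have /matrixP/(_ i ord0) := kp0; rewrite !mxE => kp0'.
by rewrite kp0' ltxx in kp.
Qed.

Lemma post_cov_sqr_le v p i : nonneg_orthant v ->
  post_cov v p i ord0 ^+ 2 <= k 0 0 * pvar v p.
Proof.
move=> v0; have Kii : gram k pts i i = k 0 0 by rewrite mxE kernel_diag.
rewrite posterior_varE// -Kii.
apply: (@resol_sqr_le _ _ prec (gram k pts)).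
- exact: prec_sym.
- exact: prec_posdef.
- exact: schur_ge0.
- exact: mulVmx.
- exact: v0.
- by rewrite Kii kernel_diag_gt0.
Qed.

Lemma posterior_var_le v p : nonneg_orthant v -> pvar v p <= k 0 0.
Proof.
move=> v0; have z0 : nonneg_orthant (0 : 'rV[R]_N) by move=> i; rewrite mxE.
apply: (@le_trans _ _ (pvar 0 p)).
  by apply: posterior_var_antitone => // i; rewrite mxE.
rewrite posterior_varE// /rform /resol.
have -> : diag_mx 0 = 0 :> 'M[R]_N by apply/matrixP => a z; rewrite !mxE mul0rn.
rewrite addr0 /prec invmxK mulKVmx// trmx_mul trmx_inv gram_sym.
by rewrite /schur /bform /prec subrK kernel_diag.
Qed.

(** In [posterior_var_sqr_le] each squared coordinate is at most k 0 0 times the variance at v, so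
    one factor of that variance cancels. The resulting relative bound does not depend on p. *)
Lemma posterior_var_lipschitz u v p : nonneg_orthant u -> nonneg_orthant v ->
  pvar v p <= pvar u p * (1 + k 0 0 * \sum_i `|u ord0 i - v ord0 i|).
Proof.
move=> u0 v0; have vp := posterior_var_gt0 p v0.
rewrite -(ler_pM2l vp) -expr2.
apply: (le_trans (posterior_var_sqr_le p u0 v0)).
rewrite mulrCA ler_pM2l ?posterior_var_gt0// mulrDr mulr1 lerD2l.
rewrite mulrCA mulrA !mulr_sumr ler_sum// => i _.
apply: le_trans (ler_norm _) _; rewrite normrM mulrC ler_wpM2r//.
by rewrite ger0_norm ?sqr_ge0// post_cov_sqr_le.
Qed.

Lemma posterior_sd_tangent u v p : nonneg_orthant u -> nonneg_orthant v ->
  2 * pvar v p <= 2 * Num.sqrt (pvar v p) * Num.sqrt (pvar u p) +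
    \sum_i (u ord0 i - v ord0 i) * post_cov v p i ord0 ^+ 2.
Proof.
move=> u0 v0; have := posterior_var_sqr_le p u0 v0.
have := posterior_var_gt0 p v0; have := posterior_var_gt0 p u0.
move=> /ltW/sqr_sqrtr eu /[dup] vp /ltW/sqr_sqrtr ev.
have s0 : 0 <= Num.sqrt (pvar u p) by exact: sqrtr_ge0.
have r0 : 0 < Num.sqrt (pvar v p) by rewrite sqrtr_gt0.
set r := Num.sqrt (pvar v p) in ev r0 *; set s := Num.sqrt (pvar u p) in eu s0 *.
rewrite -{}eu -{}ev => H; by apply: sqrt_tangent.
Qed.

(** Weight the tangent bounds at w towards u and v by t and 1 - t. The sums cancel because t (u - w)
    + (1 - t) (v - w) = 0; divide by twice the standard deviation at w. *)
Lemma posterior_sd_convex u v p t : nonneg_orthant u -> nonneg_orthant v ->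
  0 <= t -> t <= 1 ->
  Num.sqrt (pvar (t *: u + (1 - t) *: v) p) <=
  t * Num.sqrt (pvar u p) + (1 - t) * Num.sqrt (pvar v p).
Proof.
move=> u0 v0 t0 t1; set w := t *: u + _.
have w0 : nonneg_orthant w.
  by move=> i; rewrite !mxE addr_ge0// mulr_ge0// subr_ge0.
have sw : 0 < Num.sqrt (pvar w p) by rewrite sqrtr_gt0 posterior_var_gt0.
have := posterior_sd_tangent p v0 w0; have := posterior_sd_tangent p u0 w0.
have := sqr_sqrtr (ltW (posterior_var_gt0 p w0)) => e.
rewrite -{1 3}e.
set Su := \sum_i _; set Sv := \sum_i _ => Hu Hv.
have S0 : t * Su + (1 - t) * Sv = 0.
  rewrite /Su /Sv !mulr_sumr -big_split big1// => i _ /=.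
  by rewrite !mxE; ring.
have t1' : 0 <= 1 - t by rewrite subr_ge0.
have := ler_wpM2l t0 Hu; have := ler_wpM2l t1' Hv.
move: Hu Hv S0 sw => _ _.
move: (Num.sqrt _) (Num.sqrt _) (Num.sqrt _) Su Sv => a a' c Su Sv S0 c0 Hu Hv.
by rewrite -(ler_pM2l c0); lra.
Qed.

End posterior_variance.

(** * The error as a function of the standard deviations *)

Section powR_facts.
Context {R : realType}.
Implicit Types (x y t p : R).

Lemma powR_convex p t x y : 1 <= p -> 0 <= t -> t <= 1 -> 0 <= x -> 0 <= y ->
  (t * x + (1 - t) * y) `^ p <= t * x `^ p + (1 - t) * y `^ p.
Proof.
move=> p1 t0 t1 x0 y0.
by apply: (convex_powR p1 (Itv01 t0 t1)); rewrite inE/= in_itv/= andbT.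
Qed.

Lemma ler_powRl p x y : 0 <= p -> 0 <= x -> x <= y -> x `^ p <= y `^ p.
Proof.
by move=> p0 x0 xy; apply: ge0_ler_powR; rewrite ?nnegrE// (le_trans x0).
Qed.

Lemma ltr_powRl p x y : 0 < p -> 0 <= x -> x < y -> x `^ p < y `^ p.
Proof.
move=> p0 x0 xy; apply: gt0_ltr_powR; rewrite ?nnegrE//.
by rewrite (le_trans x0)// ltW.
Qed.

Lemma powR_sqr_half p x : 0 <= x -> (x ^+ 2) `^ (p / 2) = x `^ p.
Proof.
by move=> x0; rewrite -powR_mulrn// -powRrM; congr (_ `^ _); field.
Qed.

End powR_facts.

(** The largest entry bounds the image of the unit ball, and each entry is reached at its unit
    vector. *)
Lemma spectral_norm_diag (R : realType) m (x : 'I_m -> R) : (forall c, 0 <= x c) ->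
  spectral_norm (diag_mx (\row_c x c)) = \big[Num.max/0]_c x c.
Proof.
move=> x0; set M := \big[Num.max/0]_c x c.
have M0 : 0 <= M by exact: bigmax_ge_id.
have xM c : x c <= M by exact: le_bigmax.
have ub : ubound [set euclidean_norm (diag_mx (\row_c x c) *m y) |
    y in [set y : 'cV_m | euclidean_norm y <= 1]] M.
  move=> _ [y /= y1 <-]; apply: (@le_trans _ _ (Num.sqrt (M ^+ 2))); last first.
    by rewrite sqrtr_sqr ger0_norm.
  rewrite ler_wsqrtr//.
  apply: (@le_trans _ _ (M ^+ 2 * \sum_i y i ord0 ^+ 2)).
    rewrite mulr_sumr ler_sum// => i _; rewrite diag_mx_mulE mxE exprMn.
    by rewrite ler_wpM2r ?sqr_ge0// lerXn2r ?nnegrE.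
  rewrite -[leRHS]mulr1 ler_wpM2l ?sqr_ge0//.
  move: y1; rewrite /euclidean_norm -{1}(@sqrtr1 R) ler_sqrt//.
have ne : [set euclidean_norm (diag_mx (\row_c x c) *m y) |
    y in [set y : 'cV_m | euclidean_norm y <= 1]] !=set0.
  exists 0, 0; last first.
    by rewrite mulmx0 /euclidean_norm big1 ?sqrtr0// => i _; rewrite mxE expr0n.
  by rewrite /= /euclidean_norm big1 ?sqrtr0// => i _; rewrite mxE expr0n.
apply/eqP; rewrite eq_le; apply/andP; split; first exact: ge_sup.
have hub : has_ubound [set euclidean_norm (diag_mx (\row_c x c) *m y) |
    y in [set y : 'cV_m | euclidean_norm y <= 1]] by exists M.
(* The default value 0 of the maximum must also lie below the supremum; any norm in the set shows
   this. *)
apply: bigmax_le => [|c _].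
  case: ne => r Er; apply: le_trans (ub_le_sup hub Er).
  by case: Er => y _ <-; exact: sqrtr_ge0.
have single (a : R) : \sum_i (if i == c then a else 0) = a.
  by rewrite -big_mkcond big_pred1_eq.
apply: (ub_le_sup hub); exists (delta_mx c ord0).
  rewrite /= /euclidean_norm -[leRHS](@sqrtr1 R) ler_wsqrtr// -[leRHS](single 1).
  by rewrite ler_sum// => i _; rewrite mxE eqxx andbT; case: eqP => _; rewrite ?expr1n ?expr0n.
rewrite /euclidean_norm; have -> : x c = Num.sqrt (x c ^+ 2).
  by rewrite sqrtr_sqr ger0_norm.
congr Num.sqrt; rewrite -[RHS](single (x c ^+ 2)).
apply: eq_bigr => i _; rewrite diag_mx_mulE !mxE eqxx andbT.
by case: eqP => [->|_]; rewrite ?mulr1// mulr0 expr0n.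
Qed.

Section error_of_sd.
Context {R : realType} (em : error_model) (q : R) (m : nat).
Hypotheses (hm : (0 < m)%N) (hq : 2 <= q).
Implicit Types x y z : 'I_m -> R.

Let q_gt0 : 0 < q. Proof. by rewrite (lt_le_trans _ hq). Qed.
Let q_ge0 : 0 <= q. Proof. exact: ltW. Qed.
Let q_ge1 : 1 <= q. Proof. by rewrite (le_trans _ hq)// ler1n. Qed.

Let q2_gt0 : 0 < q / 2. Proof. by rewrite divr_gt0. Qed.
Let q2_ge1 : 1 <= q / 2. Proof. by rewrite ler_pdivlMr ?mul1r. Qed.

Definition spectral_const : R := (m%:R * (1 - 2 / (9 * m%:R)) ^+ 3) `^ (q / 2).

Definition sd_error x : R :=
  match em with
  | SpectralError => spectral_const * (\big[Num.max/0]_c x c) `^ q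
  | TraceError => \sum_c x c `^ q
  end.

Lemma error_powE x : (forall c, 0 <= x c) ->
  error_pow em q (diag_mx (\row_c x c)) = sd_error x.
Proof.
rewrite /sd_error => x0; case: em => /=; first by rewrite spectral_norm_diag.
by apply: eq_bigr => c _; rewrite !mxE eqxx mulr1n.
Qed.

(** For m >= 1 the factor 1 - 2 / (9 m) is at least 7 / 9. *)
Lemma spectral_const_gt0 : 0 < spectral_const.
Proof.
have m1 : 1 <= m%:R :> R by rewrite ler1n.
apply/powR_gt0/mulr_gt0; first exact: lt_le_trans m1.
rewrite exprn_gt0// subr_gt0 ltr_pdivrMr ?mul1r; lra.
Qed.

Let mx x := \big[Num.max/0]_c x c.

Let mx_ge0 x : 0 <= mx x.
Proof. exact: bigmax_ge_id. Qed.

Let mx_arg x : (forall c, 0 <= x c) -> exists c, mx x = x c.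
Proof.
move=> x0.
by have [|c _ e] := @eq_bigmax _ _ 'I_m 0 (Ordinal hm) predT x isT; [|exists c].
Qed.

Let le_mx x c : x c <= mx x.
Proof. exact: le_bigmax. Qed.

Lemma sd_error_le x y : (forall c, 0 <= x c) -> (forall c, x c <= y c) ->
  sd_error x <= sd_error y.
Proof.
rewrite /sd_error => x0 xy; case: em; last first.
  by rewrite ler_sum// => c _; rewrite ler_powRl.
rewrite ler_pM2l ?spectral_const_gt0// ler_powRl ?mx_ge0//.
by apply: bigmax_le => [|c _]; [exact: mx_ge0|exact: le_trans (le_mx _ _)].
Qed.

Lemma sd_error_scale a x : 0 <= a -> (forall c, 0 <= x c) ->
  sd_error (fun c => a * x c) = a `^ q * sd_error x.
Proof.
rewrite /sd_error => a0 x0; case: em; last first.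
  by rewrite mulr_sumr; apply: eq_bigr => c _; rewrite powRM.
rewrite mulrCA -powRM ?mx_ge0//; congr (_ * _ `^ _).
apply/eqP; rewrite eq_le; apply/andP; split.
  by apply: bigmax_le => [|c _]; [rewrite mulr_ge0 ?mx_ge0|rewrite ler_wpM2l ?le_mx].
have [c e] := mx_arg x0; rewrite -/(mx x) e.
exact: (@le_bigmax _ _ _ 0 (fun c => a * x c)).
Qed.

Lemma sd_error_gt0 x : (forall c, 0 < x c) -> 0 < sd_error x.
Proof.
rewrite /sd_error => x0; case: em.
  rewrite mulr_gt0 ?spectral_const_gt0// powR_gt0//.
  exact: (lt_le_trans (x0 (Ordinal hm)) (le_mx _ _)).
rewrite (bigD1 (Ordinal hm))//= ltr_pwDl ?powR_gt0// sumr_ge0// => c _.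
exact: powR_ge0.
Qed.

Lemma sd_error_convex t x y : 0 <= t -> t <= 1 -> (forall c, 0 <= x c) ->
  (forall c, 0 <= y c) ->
  sd_error (fun c => t * x c + (1 - t) * y c) <=
  t * sd_error x + (1 - t) * sd_error y.
Proof.
move=> t0 t1 x0 y0; have t1' : 0 <= 1 - t by rewrite subr_ge0.
rewrite /sd_error; case: em; last first.
  rewrite !mulr_sumr -big_split ler_sum// => c _; exact: powR_convex.
rewrite mulrCA [X in _ <= _ + X]mulrCA -mulrDr ler_pM2l ?spectral_const_gt0//.
rewrite -/(mx _) -/(mx x) -/(mx y).
have [|c ->] := @mx_arg (fun c => t * x c + (1 - t) * y c).
  by move=> c; rewrite addr_ge0// mulr_ge0.
apply: (le_trans (powR_convex _ _ _ _ _)) => //.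
by rewrite lerD// ler_wpM2l// ler_powRl// le_mx.
Qed.

(* The components that determine the value of sd_error. *)
Definition active x c :=
  if em is SpectralError then forall c', x c' <= x c else True.

(** Written as (x^2)^(q/2), the q-th power is convex in the variance because q >= 2. A strict
    inequality between the variances of an active component would therefore push the whole error
    strictly below the average. *)
Lemma sd_error_midpoint_active x y z c :
  (forall c, 0 <= x c) -> (forall c, 0 <= y c) -> (forall c, 0 <= z c) ->
  (forall c, x c ^+ 2 <= (y c ^+ 2 + z c ^+ 2) / 2) ->
  (sd_error y + sd_error z) / 2 <= sd_error x -> active x c ->
  x c ^+ 2 = (y c ^+ 2 + z c ^+ 2) / 2.
Proof.
move=> x0 y0 z0 xyz le_yzx act; apply/eqP; rewrite eq_le xyz leNgt.
apply/negP => lt_xyz.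
have half : (1 : R) - 2^-1 = 2^-1 by lra.
have mid a b : (a + b) / 2 = 2^-1 * a + (1 - 2^-1) * b :> R by rewrite half; ring.
have conv c' : ((y c' ^+ 2 + z c' ^+ 2) / 2) `^ (q / 2) <=
    2^-1 * y c' `^ q + (1 - 2^-1) * z c' `^ q.
  rewrite -(powR_sqr_half q (y0 c')) -(powR_sqr_half q (z0 c')) mid.
  by apply: powR_convex; rewrite ?sqr_ge0// ?invf_le1 ?ler1n.
have lt_c : x c `^ q < 2^-1 * y c `^ q + (1 - 2^-1) * z c `^ q.
  rewrite -powR_sqr_half//; apply: lt_le_trans (conv c).
  by rewrite ltr_powRl ?sqr_ge0.
have le_c c' : x c' `^ q <= 2^-1 * y c' `^ q + (1 - 2^-1) * z c' `^ q.
  rewrite -powR_sqr_half//; apply: le_trans (conv c').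
  by rewrite ler_powRl ?sqr_ge0// ltW.
move: le_yzx; rewrite leNgt => /negP; apply; rewrite mid.
move: act; rewrite /active /sd_error; case: em => [act|_]; last first.
  rewrite !mulr_sumr -big_split/= (bigD1 c)//= [ltRHS](bigD1 c)//=.
  by rewrite ltr_leD// ler_sum.
rewrite mulrCA [X in _ < _ + X]mulrCA -mulrDr ltr_pM2l ?spectral_const_gt0//.
have -> : \big[Num.max/0]_c x c = x c.
  by apply/eqP; rewrite eq_le le_mx andbT; apply: bigmax_le.
apply: (lt_le_trans lt_c); rewrite half.
by rewrite lerD// ler_wpM2l ?invr_ge0// ler_powRl// le_mx.
Qed.

(** An inactive component may grow, provided that it stays below some component of x. In the trace
    model every component is active. *)
Lemma sd_error_lt x y : (forall c, 0 <= y c) ->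
  (forall c, active x c -> y c < x c) ->
  (forall c, ~ active x c -> exists c', y c < x c') ->
  sd_error y < sd_error x.
Proof.
move=> y0; rewrite /active /sd_error; case: em => act inact; last first.
  rewrite (bigD1 (Ordinal hm))//= [ltRHS](bigD1 (Ordinal hm))//=.
  rewrite ltr_leD// ?ltr_powRl// ?act//.
  by rewrite ler_sum// => c _; rewrite ler_powRl// ltW// act.
rewrite ltr_pM2l ?spectral_const_gt0// ltr_powRl ?mx_ge0//.
have [c e] := mx_arg y0; rewrite -/(mx y) e -/(mx x).
have [/act xc|/inact[c' xc]] := pselect (forall c', x c' <= x c).
- exact: (lt_le_trans xc (le_mx _ _)).
- exact: (lt_le_trans xc (le_mx _ _)).
Qed.

End error_of_sd.

(** * Measurability and integration *)

Section rV_measurability.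
Context {R : realType} {d : nat}.

Lemma coord_box_measurable (P : 'I_d -> set R) : (forall i, measurable (P i)) ->
  measurable [set x : 'rV[R]_d | forall i, P i (x ord0 i)].
Proof.
move=> mP.
rewrite (_ : [set x : 'rV[R]_d | _] = \bigcap_(i in [set: 'I_d])
    ((fun x : 'rV[R]_d => x ord0 i : R) @^-1` P i)); last first.
  by apply/seteqP; split=> x H i; [move=> _; exact: H|exact: (H i I)].
apply: fin_bigcap_measurable => [|i _]; first exact: finite_finset.
by rewrite -[X in measurable X]setTI; exact: measurable_coord.
Qed.

(* Rational boxes form a countable base of the topology. *)
Lemma open_rV_measurable (U : set 'rV[R]_d) : open U -> measurable U.
Proof.
move=> oU.
pose eps n : R := n.+1%:R^-1.
pose B (rn : 'rV[rat]_d * nat) : set 'rV[R]_d :=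
  [set x | forall i, `]ratr (rn.1 ord0 i) - eps rn.2,
                       ratr (rn.1 ord0 i) + eps rn.2[%classic (x ord0 i)].
pose F rn : set 'rV[R]_d := if `[< B rn `<=` U >] then B rn else set0.
suff -> : U = \bigcup_rn F rn.
  apply: countable_bigcupT_measurable => [|rn]; first exact: countableP.
  rewrite /F; case: ifP => // _.
  apply: (@coord_box_measurable (fun i => `]ratr (rn.1 ord0 i) - eps rn.2,
    ratr (rn.1 ord0 i) + eps rn.2[%classic)) => i.
  exact: measurable_itv.
apply/seteqP; split => [x Ux|x [rn _]]; last first.
  by rewrite /F; case: asboolP => // BU /BU.
have : nbhs x U by exact: open_nbhs_nbhs.
move=> /nbhs_ballP[e /= e0 xeU].
(* Both x and the points of the box lie within eps n of the rational centre, hence within e of each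
   other. *)
have [n ne] : exists n, eps n < e / 2.
  have /ltr_add_invr[n] : 0 < e / 2 by rewrite divr_gt0.
  by rewrite add0r => ?; exists n.
have n0 : 0 < eps n by rewrite invr_gt0.
have /choice[r rP] : forall i, exists r : rat,
    ratr r \in `]x ord0 i - eps n, x ord0 i + eps n[.
  move=> i; have /rat_in_itvoo[r rx] : x ord0 i - eps n < x ord0 i + eps n.
    by rewrite ltrBlDr -addrA ltrDl addr_gt0.
  by exists r.
exists (\row_i r i, n) => //; rewrite /F; case: asboolP => [_ i|].
  have := rP i; rewrite /= !in_itv/= !mxE => /andP[? ?].
  by rewrite ltrBlDr -[X in _ && X]ltrBlDr; apply/andP.
case=> y By; apply: xeU; split => // a i.
have -> : a = ord0 by exact: ord1.
have := By i; have := rP i; rewrite /ball/= !in_itv/= !mxE => /andP[y1 y2] /andP[r1 r2].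
move: ne y1 y2 r1 r2; move: (eps n) => c ? ? ? ? ?.
by rewrite ltr_norml; apply/andP; split; lra.
Qed.

Lemma open_lebesgue_rV_measurable (U : set 'rV[R]_d) : open U ->
  measurable (U : set (lebesgue_rVType R d)).
Proof.
move=> /open_rV_measurable mU; apply: sub_caratheodory.
exact: sub_sigma_algebra.
Qed.

Lemma closed_lebesgue_rV_measurable (U : set 'rV[R]_d) : closed U ->
  measurable (U : set (lebesgue_rVType R d)).
Proof.
move=> cU; rewrite -(setCK U); apply: measurableC.
exact/open_lebesgue_rV_measurable/closed_openC.
Qed.

Lemma continuous_lebesgue_rV_measurable (f : 'rV[R]_d -> R)
    (D : set (lebesgue_rVType R d)) :
  continuous f -> measurable D -> measurable_fun D (f : lebesgue_rVType R d -> R).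
Proof.
move=> /continuousP cf mD; apply: (measurability _ (RGenOpens.measurableE R)).
move=> _ [_ [a [b ->] <-]]; apply: measurableI => //.
exact/open_lebesgue_rV_measurable/cf/interval_open.
Qed.

Lemma lebesgue_rV_bounded_lty (X : set 'rV[R]_d) :
  measurable (X : set (lebesgue_rVType R d)) ->
  bounded_set X -> (lebesgue_rV X < +oo)%E.
Proof.
move=> mX [M [Mr /(_ (`|M| + 1))]].
rewrite (le_lt_trans (ler_norm M)) ?ltrDl// => /(_ isT) XM.
pose b : 'rV[R]_d := const_mx (`|M| + 1).
pose B : set 'rV[R]_d :=
  [set x | forall i, x ord0 i \in `[(- b) ord0 i, b ord0 i]].
have mB : measurable B.
  exact: (@coord_box_measurable (fun i => `[(- b) ord0 i, b ord0 i]%classic)).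
have XB : X `<=` B.
  move=> x /XM /= xM i; rewrite in_itv/= !mxE -ler_norml.
  apply: le_trans xM; rewrite /Num.norm/= mx_normrE.
  exact: (@le_bigmax _ _ _ 0 (fun ij => `|x ij.1 ij.2|) (ord0, i)).
apply: (@le_lt_trans _ _ (lebesgue_rV B)).
  by apply: le_measure => //; rewrite inE//; apply: sub_caratheodory;
    exact: sub_sigma_algebra.
rewrite /lebesgue_rV /completed_measure_extension measurable_mu_extE//.
have /= -> := @lebesgue_rV_borel_box R d (- b) b _; first exact: ltry.
by move=> i; rewrite !mxE -subr_ge0 opprK !addr_ge0.
Qed.

End rV_measurability.

(** * Bounded measurable functions on a set of finite positive measure *)

Section bounded_integrals.
Context d (T : measurableType d) (R : realType).
Variables (mu : {measure set T -> \bar R}) (X : set T).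
Hypotheses (mX : measurable X) (Xoo : (mu X < +oo)%E) (X0 : (0 < mu X)%E).
Implicit Types f g : T -> R.

Definition bmeasurable f :=
  measurable_fun X f /\ exists B, forall x, X x -> `|f x| <= B.

Lemma bmeasurable_integrable f : bmeasurable f -> mu.-integrable X (EFin \o f).
Proof.
move=> [mf [B fB]]; apply: measurable_bounded_integrable => //.
exists B; split; first exact: num_real.
by move=> M BM x Xx /=; rewrite (le_trans (fB x Xx))// ltW.
Qed.

Lemma bmeasurableD f g : bmeasurable f -> bmeasurable g ->
  bmeasurable (fun x => f x + g x).
Proof.
move=> [mf [B fB]] [mg [C gC]]; split; first exact: measurable_funD.
by exists (B + C) => x Xx; rewrite (le_trans (ler_normD _ _))// lerD ?fB ?gC.
Qed.

Lemma bmeasurableZ a f : bmeasurable f -> bmeasurable (fun x => a * f x).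
Proof.
move=> [mf [B fB]]; split; first by apply: measurable_funM.
by exists (`|a| * B) => x Xx; rewrite normrM ler_wpM2l// fB.
Qed.

Lemma Rintegral_linear a b f g : bmeasurable f -> bmeasurable g ->
  \int[mu]_(x in X) (a * f x + b * g x) =
  a * (\int[mu]_(x in X) f x) + b * (\int[mu]_(x in X) g x).
Proof.
move=> bf bg; rewrite RintegralD//.
- by rewrite !RintegralZl//; exact: bmeasurable_integrable.
- exact/bmeasurable_integrable/bmeasurableZ.
- exact/bmeasurable_integrable/bmeasurableZ.
Qed.

Lemma bmeasurable_le f g : bmeasurable f -> bmeasurable g ->
  (forall x, X x -> f x <= g x) ->
  \int[mu]_(x in X) f x <= \int[mu]_(x in X) g x.
Proof. by move=> bf bg; apply: le_Rintegral => //; exact: bmeasurable_integrable. Qed.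

(** A zero integral would make f vanish almost everywhere on X, so X would be a null set. *)
Lemma Rintegral_gt0 f : bmeasurable f -> (forall x, X x -> 0 < f x) ->
  0 < \int[mu]_(x in X) f x.
Proof.
move=> bf f0; have int_f := bmeasurable_integrable bf.
have f_ge0 : 0 <= \int[mu]_(x in X) f x.
  by apply: Rintegral_ge0 => x /f0/ltW.
rewrite lt_neqAle f_ge0 andbT eq_sym; apply/negP => /eqP int0.
have mf : measurable_fun X (EFin \o f) by apply/measurable_EFinP; case: bf.
have : (\int[mu]_(x in X) `|(EFin \o f) x| = 0)%E.
  under eq_integral => x /set_mem Xx do rewrite /= gtr0_norm ?f0//.
  rewrite -[LHS]fineK; first by rewrite [fine _]int0.
  exact: integrable_fin_num.
move=> /(ae_eq_integral_abs mu mX mf)[N [mN muN XN]].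
suff : (mu X <= mu N)%E by rewrite muN leNgt X0.
apply: le_measure; rewrite ?inE// => x Xx; apply: XN => /(_ Xx)/= [fx].
by have := f0 x Xx; rewrite fx ltxx.
Qed.

(** This passes from integrals to a single point. If at every point some r n were negative, the
    limit of the truncated sequence would be negative on all of X and so would its integral, while
    truncation from below keeps all the integrals nonnegative. *)
Lemma Rintegral_nonincreasing_ge0 (r : nat -> T -> R) :
  (forall n, bmeasurable (r n)) ->
  (forall x, X x -> {homo r^~ x : m n / (m <= n)%N >-> n <= m}) ->
  (forall n, 0 <= \int[mu]_(x in X) r n x) ->
  exists2 x, X x & forall n, 0 <= r n x.
Proof.
move=> br decr int_r; apply: contrapT => Nr.
have rlt x : X x -> exists n, r n x < 0.
  move=> Xx; apply: contrapT => Nrx; apply: Nr; exists x => // n.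
  by rewrite leNgt; apply/negP => rn0; apply: Nrx; exists n.
(* Truncation makes dominated convergence applicable. *)
pose g n x := Num.max (r n x) (-1).
have [B0 rB0] : exists B, forall x, X x -> `|r 0 x| <= B by case: (br 0).
pose B := Num.max B0 1.
have gB n x : X x -> `|g n x| <= B.
  move=> Xx; rewrite ler_norml; apply/andP; split.
    by rewrite le_max lerN2 le_max lexx !orbT.
  rewrite ge_max; apply/andP; split; rewrite le_max.
    by rewrite (le_trans (decr x Xx 0 n _))// (le_trans (ler_norm _))// rB0.
  by apply/orP; right; rewrite (le_trans _ ler01)// lerN10.
have mg n : measurable_fun X (g n).
  by apply: measurable_maxr => //; case: (br n).
have bg n : bmeasurable (g n) by split => //; exists B; exact: gB.
have gdecr x : X x -> nonincreasing_seq (g^~ x).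
  by move=> Xx m n mn; rewrite ge_max !le_max decr//= lexx orbT.
pose f x := limn (g^~ x).
have g_lb x : X x -> has_lbound (range (g^~ x)).
  by move=> Xx; exists (-1) => _ [n _ <-]; rewrite le_max lexx orbT.
have gf x : X x -> g^~ x @ \oo --> f x.
  by move=> Xx; apply: nonincreasing_is_cvgn; [exact: gdecr|exact: g_lb].
have mf : measurable_fun X f.
  by apply: (measurable_fun_cvg mg) => x /gf.
have f_lt0 x : X x -> f x < 0.
  move=> Xx; have [n rn] := rlt x Xx; apply: (@le_lt_trans _ _ (g n x)).
    apply: nonincreasing_cvgn_ge; [exact: gdecr|].
    by apply/cvg_ex; exists (f x); exact: gf.
  by rewrite gt_max rn ltrN10.
have f_ge x : X x -> -1 <= f x.
  move=> Xx; apply: limr_ge; first by apply/cvg_ex; exists (f x); exact: gf.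
  by apply: nearW => n; rewrite le_max lexx orbT.
have bf : bmeasurable f.
  split => //; exists 1 => x Xx; rewrite ler_norml f_ge//=.
  by rewrite (le_trans (ltW (f_lt0 x Xx))).
have [] := @dominated_convergence _ _ _ mu X mX (fun n => EFin \o g n)
    (EFin \o f) (EFin \o cst B).
- by move=> n; apply/measurable_EFinP.
- exact/measurable_EFinP.
- by apply: aeW => x Xx; apply: cvg_EFin; [exact: nearW|exact: gf].
- by apply: bmeasurable_integrable; split => //; exists `|B|.
- by apply: aeW => x n Xx /=; rewrite lee_fin gB.
move=> _ _ cv.
have : (0 <= \int[mu]_(x in X) (EFin \o f) x)%E.
  rewrite -(cvg_lim _ cv)//; apply: lime_ge; first by apply/cvg_ex; eexists; exact: cv.
  apply: nearW => n.
  rewrite -[leRHS]fineK; last exact/integrable_fin_num/bmeasurable_integrable.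
  rewrite lee_fin; apply: (le_trans (int_r n)).
  by apply: bmeasurable_le => // x Xx; rewrite le_max lexx.
move/fine_ge0; rewrite leNgt => /negP; apply.
have : 0 < \int[mu]_(x in X) (-1 * f x).
  apply: Rintegral_gt0 => [|x Xx]; first exact: bmeasurableZ.
  by rewrite mulN1r oppr_gt0 f_lt0.
rewrite RintegralZl//; last exact: bmeasurable_integrable.
by rewrite mulN1r oppr_gt0.
Qed.

End bounded_integrals.

(** * The admissible set *)

Section admissible_set.
Context {R : realType}.
Variables (s : R) (hs : 1 <= s).

Let s_gt0 : 0 < s. Proof. by rewrite (lt_le_trans _ hs). Qed.
Let s_ge0 : 0 <= s. Proof. exact: ltW. Qed.

Lemma nonneg_orthant_conv N (u v : 'rV[R]_N) t : 0 <= t -> t <= 1 ->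
  nonneg_orthant u -> nonneg_orthant v -> nonneg_orthant (t *: u + (1 - t) *: v).
Proof.
by move=> t0 t1 u0 v0 i; rewrite !mxE addr_ge0// mulr_ge0// subr_ge0.
Qed.

Lemma work_convex N (u v : 'rV[R]_N) t : 0 <= t -> t <= 1 ->
  nonneg_orthant u -> nonneg_orthant v ->
  work s (t *: u + (1 - t) *: v) <= t * work s u + (1 - t) * work s v.
Proof.
move=> t0 t1 u0 v0; rewrite /work !mulr_sumr -big_split/= ler_sum// => i _.
by rewrite !mxE powR_convex.
Qed.

Lemma work_lt N (u v : 'rV[R]_N) i : nonneg_orthant u ->
  (forall l, u ord0 l <= v ord0 l) -> u ord0 i < v ord0 i -> work s u < work s v.
Proof.
move=> u0 uv uvi; rewrite /work (bigD1 i)//= [ltRHS](bigD1 i)//=.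
rewrite ltr_leD ?ltr_powRl//.
by rewrite ler_sum// => l _; exact: ler_powRl.
Qed.

Lemma work_ge0 N (u : 'rV[R]_N) : 0 <= work s u.
Proof. by apply: sumr_ge0 => i _; exact: powR_ge0. Qed.

Variables (n j : nat) (eps : 'I_n -> R) (DW : R).
Hypotheses (eps_gt0 : forall i, 0 < eps i) (DW_gt0 : 0 < DW).

Let A := admissible s DW eps : set 'rV[R]_(n + j).
Let C := DW + work_of_tolerances s eps.

Lemma admissible_conv u v t : 0 <= t -> t <= 1 -> A u -> A v ->
  A (t *: u + (1 - t) *: v).
Proof.
move=> t0 t1 [u0 lu Wu] [v0 lv Wv]; have t1' : 0 <= 1 - t by rewrite subr_ge0.
split=> [|i|]; first exact: nonneg_orthant_conv.
  rewrite [leRHS]mxE [X in _ <= X + _]mxE [X in _ <= _ + X]mxE.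
  have -> : lower_bound j eps ord0 i =
      t * lower_bound j eps ord0 i + (1 - t) * lower_bound j eps ord0 i by ring.
  by rewrite lerD// ler_wpM2l.
apply: (le_trans (work_convex _ _ _ _)) => //; rewrite -/C.
have -> : C = t * C + (1 - t) * C by ring.
by rewrite lerD// ler_wpM2l.
Qed.

Lemma admissible_convex_set : convex_set A.
Proof.
move=> u v t /set_mem Au /set_mem Av; apply/mem_set.
exact: admissible_conv.
Qed.

Lemma admissible_nonempty : A !=set0.
Proof.
exists (lower_bound j eps); split=> [i||].
- rewrite mxE; case: fintype.splitP => l _; rewrite mxE//.
  by rewrite invr_ge0 exprn_ge0// ltW.
- by [].
rewrite /work big_split_ord/= [X in _ + X]big1 ?addr0; last first.
  by move=> i _; rewrite row_mxEr mxE powR0// gt_eqF.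
apply: (@le_trans _ _ (work_of_tolerances s eps)); last by rewrite lerDr ltW.
apply: ler_sum => i _; rewrite row_mxEl mxE.
have e0 := ltW (eps_gt0 i).
rewrite -(powR_mulrn 2 e0) -powR_inv1 ?powR_ge0// -!powRrM.
by rewrite [X in _ `^ X <= _](_ : _ = - (2 * s)) ?lexx//; ring.
Qed.

(** A coordinate above 1 is at most its own s-th power, hence at most the budget. *)
Lemma admissible_bounded : bounded_set A.
Proof.
exists (Num.max 1 C); split; first exact: num_real.
move=> M CM v [v0 _ Wv]; rewrite /Num.norm/= mx_normrE.
apply: bigmax_le => [|[a i] _ /=].
  by rewrite (le_trans _ (ltW CM))// le_max ler01.
have -> : a = ord0 by exact: ord1.
rewrite (le_trans _ (ltW CM))// ger0_norm// le_max.
have [//|v1] := leP (v ord0 i) 1.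
apply: le_trans Wv; apply: (@le_trans _ _ (v ord0 i `^ s)).
  by rewrite -{1}(powRr1 (v0 i)) ler_powR// ltW.
by rewrite /work (bigD1 i)//= lerDl sumr_ge0// => l _; exact: powR_ge0.
Qed.

Lemma near_coord N (v : 'rV[R]_N) i (e : R) : 0 < e ->
  nbhs v [set x : 'rV[R]_N | `|v ord0 i - x ord0 i| < e].
Proof.
by move=> e0; apply/nbhs_ballP; exists e => // x [_ /(_ ord0 i)].
Qed.

Lemma admissible_closed : closed A.
Proof.
(* If the budget were exceeded at v, it would be exceeded at t *: v for some
   t < 1, hence at any nearby admissible point, which dominates t *: v. *)
move=> v clv.
have ge_coord i a : (forall x, A x -> a <= x ord0 i) -> a <= v ord0 i.
  move=> Aa; rewrite leNgt; apply/negP => va.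
  have va0 : 0 < a - v ord0 i by rewrite subr_gt0.
  have [x [/Aa ax /=]] := clv _ (near_coord v i va0).
  by rewrite ltr_norml => /andP[+ _]; rewrite opprB ltrD2l ltrN2 ltNge ax.
have v0 : nonneg_orthant v by move=> i; apply: ge_coord => x [].
split=> [//|i|]; first by apply: ge_coord => x [].
have C0 : 0 <= C by have [x [_ _ /(le_trans (work_ge0 _))]] := admissible_nonempty.
rewrite -/C leNgt; apply/negP => CW.
have W0 : 0 < work s v by exact: le_lt_trans CW.
(* The factor r lies halfway between C / W(v) and 1. With t = r^(1/s) one gets W(t v) = r W(v),
   which still exceeds C. *)
pose r := (C / work s v + 1) / 2.
have CW1 : C / work s v < 1 by rewrite ltr_pdivrMr// mul1r.
have CW0 : 0 <= C / work s v by rewrite divr_ge0// ltW.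
have r0 : 0 < r by rewrite /r; lra.
have r1 : r < 1 by rewrite /r; lra.
have rW : C < r * work s v.
  have -> : r * work s v = (C + work s v) / 2 by rewrite /r; field; rewrite gt_eqF.
  lra.
pose t := r `^ s^-1.
have ts : t `^ s = r by rewrite /t -powRrM mulVf ?gt_eqF// powRr1// ltW.
have t0 : 0 <= t by exact: powR_ge0.
have t1 : t < 1.
  have <- : 1 `^ s^-1 = 1 :> R by rewrite powR1.
  by rewrite ltr_powRl// ?invr_gt0// ltW.
have : nbhs v [set x : 'rV[R]_(n + j) |
    forall i, 0 < v ord0 i -> t * v ord0 i < x ord0 i].
  apply: (@filter_forall _ 'I_(n + j) (fun i => [set x : 'rV[R]_(n + j) |
    0 < v ord0 i -> t * v ord0 i < x ord0 i]) (nbhs v)) => i.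
  have [vi|vi] := ltP 0 (v ord0 i); last first.
    by apply: filterS filterT.
  have d0 : 0 < (1 - t) * v ord0 i by rewrite mulr_gt0// subr_gt0.
  apply: filterS (near_coord v i d0) => x /= + _.
  rewrite ltr_norml => /andP[_]; lra.
move=> /clv[x [[x0 _ Wx] xB]].
move: rW; rewrite ltNge => /negP; apply; apply: le_trans Wx.
rewrite /work mulr_sumr ler_sum// => i _; rewrite -ts -powRM//.
rewrite ler_powRl ?mulr_ge0//.
have := v0 i; rewrite le_eqVlt => /predU1P[<-|/(xB i)/ltW//].
by rewrite mulr0.
Qed.

Lemma admissible_compact : compact A.
Proof. exact: bounded_closed_compact admissible_bounded admissible_closed. Qed.

End admissible_set.

(* Lowering the i-th coordinate of the midpoint leaves slack in the budget,
   which is then spent on the other coordinates. *)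
Lemma admissible_exchange (R : realType) (s DW : R) n j (eps : 'I_n -> R)
    (u v : 'rV[R]_(n + j)) i : 1 <= s ->
  admissible s DW eps u -> admissible s DW eps v -> v ord0 i < u ord0 i ->
  exists z, admissible s DW eps z /\
    forall l, l != i -> (2^-1 *: u + (1 - 2^-1) *: v) ord0 l < z ord0 l.
Proof.
move=> hs Au Av vui.
have [x0 lx Wx] : admissible s DW eps (2^-1 *: u + (1 - 2^-1) *: v).
  by apply: admissible_conv => //; rewrite ?invr_ge0// invf_le1 ?ler1n.
set x := 2^-1 *: u + _ in x0 lx Wx *.
have [v0 lv _] := Av.
(* In x' coordinate i drops to its smaller value v_i; y also raises every other coordinate by 1. The
   new point is a convex combination of the two, close enough to x' to fit the budget. *)
pose x' : 'rV[R]_(n + j) := \row_l if l == i then v ord0 i else x ord0 l.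
pose y : 'rV[R]_(n + j) := \row_l if l == i then v ord0 i else x ord0 l + 1.
have x'0 : nonneg_orthant x' by move=> l; rewrite mxE; case: ifP.
have y0 : nonneg_orthant y by move=> l; rewrite mxE; case: ifP => // _; rewrite addr_ge0.
have lt_W : work s x' < work s x.
  have xi : v ord0 i < x ord0 i.
    rewrite !mxE -ltrBlDr (_ : v ord0 i - _ = 2^-1 * v ord0 i); last by field.
    by rewrite ltr_pM2l// invr_gt0.
  apply: (work_lt hs (i := i)) => //; last by rewrite mxE eqxx.
  by move=> l; rewrite mxE; case: eqP => // ->; exact: ltW.
set C := DW + _ in Wx.
have gap0 : 0 < C - work s x' by rewrite subr_gt0 (lt_le_trans lt_W).
have den0 : 0 < C - work s x' + work s y by rewrite ltr_pwDl// work_ge0.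
(* With this t the convexity bound t W(y) + (1 - t) W(x') equals (1 - t) C. *)
pose t := (C - work s x') / (C - work s x' + work s y).
have t0 : 0 < t by rewrite divr_gt0.
have t1 : t <= 1 by rewrite ler_pdivrMr// mul1r lerDl work_ge0.
have zE l : (t *: y + (1 - t) *: x') ord0 l =
    if l == i then v ord0 i else x ord0 l + t.
  by rewrite !mxE; case: eqP => _; ring.
exists (t *: y + (1 - t) *: x'); split; last first.
  by move=> l /negbTE li; rewrite zE li ltrDl.
split; first by apply: nonneg_orthant_conv => //; exact: ltW.
  move=> l; rewrite zE; case: eqP => [->//|_].
  by rewrite (le_trans (lx l))// lerDl ltW.
apply: (le_trans (work_convex hs (ltW t0) t1 y0 x'0)).
have tE : t * (C - work s x' + work s y) = C - work s x'.
  by rewrite /t divfK// lt0r_neq0.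
move: tE t0 (work_ge0 s x') gap0; rewrite -/C.
move: (work s x') (work s y) => a b tE t0 a0 gap0.
have := mulr_ge0 (ltW t0) (ltW gap0); have := mulr_ge0 (ltW t0) a0; lra.
Qed.

(** * The design problem *)

Lemma measurable_bigmax d (T : measurableType d) (R : realType) (D : set T)
    (I : Type) (s : seq I) (h : I -> T -> R) :
  (forall i, measurable_fun D (h i)) ->
  measurable_fun D (fun x => \big[Num.max/0]_(i <- s) h i x).
Proof.
move=> mh; elim: s => [|i s IH].
  by under eq_fun do rewrite big_nil; exact: measurable_cst.
under eq_fun do rewrite big_cons.
exact: measurable_maxr.
Qed.

Section quadratic_measurability.
Context dT (T : measurableType dT) (R : realType) (N : nat) (D : set T).
Implicit Types f g : T -> 'cV[R]_N.

Definition cV_measurable f := forall i, measurable_fun D (fun x => f x i ord0).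

Lemma cV_measurable_mulmx f (M : 'M[R]_N) :
  cV_measurable f -> cV_measurable (fun x => M *m f x).
Proof.
move=> mf i; under eq_fun do rewrite mxE.
apply: measurable_sum => l.
by apply: measurable_funM; [exact: measurable_cst|exact: mf].
Qed.

Lemma measurable_dotmx f g : cV_measurable f -> cV_measurable g ->
  measurable_fun D (fun x => ((f x)^T *m g x) ord0 ord0).
Proof.
move=> mf mg; under eq_fun do rewrite mxE.
apply: measurable_sum => l; apply: measurable_funM; last exact: mg.
by under eq_fun do rewrite mxE; exact: mf.
Qed.

Lemma measurable_rform (A : 'M[R]_N) f (a : R) v : cV_measurable f ->
  measurable_fun D (fun x => rform A (A *m f x) (a - bform A (f x) (f x)) v).
Proof.
move=> mf; rewrite /rform /bform /resol; apply: measurable_funD.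
  apply: measurable_funB; first exact: measurable_cst.
  under eq_fun do rewrite -mulmxA.
  by apply: measurable_dotmx => //; exact: cV_measurable_mulmx.
by apply: measurable_dotmx; do ?apply: cV_measurable_mulmx.
Qed.

End quadratic_measurability.

(** [posterior_var] inverts a matrix that depends on p. In the form of [posterior_varE] only fixed
    matrices are inverted, which leaves a quadratic polynomial in the continuous functions k (pts i)
    p. *)
Lemma measurable_posterior_var (R : realType) d N (pts : 'I_N -> 'rV[R]_d)
    (k : 'rV[R]_d -> 'rV[R]_d -> R) (D : set (lebesgue_rVType R d)) v :
  injective pts -> covariance_kernel k -> measurable D -> nonneg_orthant v ->
  measurable_fun D (fun p : lebesgue_rVType R d => posterior_var pts v k p).
Proof.
move=> pts_inj k_cov mD v0.
have -> : (fun p : lebesgue_rVType R d => posterior_var pts v k p) =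
  (fun p : lebesgue_rVType R d => rform (prec pts k) (prec pts k *m cross_cov pts k p)
    (k 0 0 - bform (prec pts k) (cross_cov pts k p) (cross_cov pts k p)) v).
  by apply/funext => p; rewrite posterior_varE// /schur kernel_diag.
apply: measurable_rform => i; under eq_fun do rewrite mxE.
apply: continuous_lebesgue_rV_measurable => // p.
have [ck _ _ _] := k_cov.
apply: (@continuous_comp _ _ _ (fun p : 'rV[R]_d => (pts i, p))
  (fun pp : 'rV[R]_d * 'rV[R]_d => k pp.1 pp.2)); last exact: ck.
have cpair := @cvg_pair _ _ _ (nbhs p) (nbhs (pts i)) (nbhs p) (nbhs_filter p)
  (nbhs_filter (pts i)) (nbhs_filter p) (fun=> pts i) id.
by apply: cpair; [exact: cvg_cst|exact: cvg_id].
Qed.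

Lemma ler_wpM2l_conv (R : realType) (a x y z t : R) : 0 <= a ->
  z <= t * x + (1 - t) * y -> a * z <= t * (a * x) + (1 - t) * (a * y).
Proof.
by move=> a0 /(ler_wpM2l a0); rewrite mulrDr (mulrCA _ t) (mulrCA _ (1 - t)).
Qed.

Lemma ler_wpM2l_comb (R : realType) (a e l l' b c x y z : R) : 0 <= a ->
  z <= e * (l * (b * x) + l' * (c * y)) ->
  a * z <= e * l * b * (a * x) + e * l' * c * (a * y).
Proof.
move=> a0 /(ler_wpM2l a0) /le_trans; apply.
by rewrite le_eqVlt; apply/orP; left; apply/eqP; ring.
Qed.

Lemma onem_half (R : realType) : 1 - 2^-1 = 2^-1 :> R.
Proof. lra. Qed.

Lemma scaled_gap_le (R : realType) (a b t h x y : R) : 0 <= b -> b * t = a ->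
  y <= t * x + (1 - t) * h -> b * y + (- b) * h <= a * x + (- a) * h.
Proof. by move=> b0 <- /(ler_wpM2l b0); lra. Qed.

Lemma conv_gap_lt (R : realType) (t h x y D : R) : 0 < t -> y - x <= D ->
  t * (D + 1) < h - x -> t * y + (1 - t) * x < h.
Proof. by move=> t0 /(ler_wpM2l (ltW t0)); lra. Qed.

Lemma scaled_gap_ge0 (R : realType) (a x y : R) : 0 < a ->
  (0 <= a * x + (- a) * y <-> y <= x).
Proof. by move=> a0; rewrite mulNr -mulrBr pmulr_rge0// subr_ge0. Qed.

Lemma le_half (R : realType) (a b c S : R) :
  c <= a + S -> c <= b - S -> c <= (a + b) / 2.
Proof. lra. Qed.

Lemma half_le_tangent (R : realType) (a b c S : R) :
  c <= b - S -> (a + b) / 2 <= c -> a + S <= c.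
Proof. lra. Qed.

(** * Convexity and continuity of the error *)

Section design_problem.
Context {R : realType} {d N m : nat}.
Variables (X : set 'rV[R]_d) (pts : 'I_N -> 'rV[R]_d).
Variables (k : 'I_m -> 'rV[R]_d -> 'rV[R]_d -> R) (w : 'rV[R]_d -> R).
Variables (em : error_model) (q : R).
Hypotheses (hm : (0 < m)%N) (X_closed : closed X) (X_bounded : bounded_set X).
Hypotheses (X_pos : (0 < lebesgue_rV X)%E) (pts_inj : injective pts).
Hypotheses (k_cov : forall c, covariance_kernel (k c)).
Hypotheses (w_gt0 : forall p, X p -> 0 < w p).
Hypotheses (w_bounded : [bounded w p | p in X]).
Hypotheses (w_meas : measurable_fun (X : set (lebesgue_rVType R d)) w).
Hypothesis hq : 2 <= q.
Implicit Types (u v : 'rV[R]_N) (p : 'rV[R]_d).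

Let q_gt0 : 0 < q. Proof. by rewrite (lt_le_trans _ hq). Qed.
Let q_ge0 : 0 <= q. Proof. exact: ltW. Qed.

Let mu := @lebesgue_rV R d : {measure set (lebesgue_rVType R d) -> \bar R}.

Definition sds v p : 'I_m -> R := fun c => Num.sqrt (posterior_var pts v (k c) p).

Definition integrand v p : R := w p `^ q * sd_error em q (sds v p).

Definition error_int v : R := \int[mu]_(p in X) integrand v p.

Let mX : measurable (X : set (lebesgue_rVType R d)).
Proof. exact: closed_lebesgue_rV_measurable. Qed.

Let Xoo : (mu X < +oo)%E.
Proof. exact: lebesgue_rV_bounded_lty. Qed.

Let sds_ge0 v p c : 0 <= sds v p c.
Proof. exact: sqrtr_ge0. Qed.

Let sds_gt0 v p c : nonneg_orthant v -> 0 < sds v p c.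
Proof. by move=> v0; rewrite sqrtr_gt0 posterior_var_gt0. Qed.

Let sds_sqr v p c : nonneg_orthant v -> sds v p c ^+ 2 = posterior_var pts v (k c) p.
Proof. by move=> v0; rewrite sqr_sqrtr// ltW// posterior_var_gt0. Qed.

Definition error v : R := error_int v `^ q^-1.

Lemma total_errorE v : total_error em q X w pts k v = error v.
Proof.
rewrite /total_error /error /error_int; congr (_ `^ _); apply: eq_Rintegral => p _.
by rewrite /integrand -(error_powE em q (sds_ge0 v p)).
Qed.

Let integrand_ge0 v p : 0 <= integrand v p.
Proof.
rewrite mulr_ge0 ?powR_ge0// /sd_error; case: em.
  by rewrite mulr_ge0 ?powR_ge0.
by rewrite sumr_ge0// => c _; exact: powR_ge0.
Qed.

Let integrand_gt0 v p : nonneg_orthant v -> X p -> 0 < integrand v p.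
Proof.
move=> v0 Xp; rewrite mulr_gt0 ?powR_gt0 ?w_gt0//.
by apply: sd_error_gt0 => // c; exact: sds_gt0.
Qed.

Let integrand_le u v p a : 0 <= a -> nonneg_orthant u -> nonneg_orthant v ->
  (forall c, sds v p c <= a * sds u p c) ->
  integrand v p <= a `^ q * integrand u p.
Proof.
move=> a0 u0 v0 vu; rewrite /integrand mulrCA ler_wpM2l ?powR_ge0//.
rewrite -sd_error_scale//; exact: sd_error_le.
Qed.

Lemma bmeasurable_integrand v : nonneg_orthant v ->
  bmeasurable (X : set (lebesgue_rVType R d)) (integrand v).
Proof.
move=> v0; split.
  apply: (@measurable_funM _ (lebesgue_rVType R d)).
    exact: (measurableT_comp (measurable_powR q) w_meas).
  have msd c : measurable_fun (X : set (lebesgue_rVType R d))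
      (fun p : lebesgue_rVType R d => sds v p c).
    have -> : (fun p : lebesgue_rVType R d => sds v p c) =
        (fun p : lebesgue_rVType R d => posterior_var pts v (k c) p `^ 2^-1).
      by apply/funext => p; rewrite powR12_sqrt// ltW// posterior_var_gt0.
    apply: (measurableT_comp (measurable_powR 2^-1)).
    exact: measurable_posterior_var.
  rewrite /sd_error; case: em.
    apply: (@measurable_funM _ (lebesgue_rVType R d)); first exact: measurable_cst.
    apply: (measurableT_comp (measurable_powR q)).
    by apply: measurable_bigmax => c; exact: msd.
  apply: measurable_sum => c.
  exact: (measurableT_comp (measurable_powR q) (msd c)).
have [M [_ wM]] := w_bounded.
exists ((`|M| + 1) `^ q * sd_error em q (fun c => Num.sqrt (k c 0 0))) => p Xp.
rewrite ger0_norm ?integrand_ge0//; apply: ler_pM; first exact: powR_ge0.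
- rewrite /sd_error; case: em; first by rewrite mulr_ge0 ?powR_ge0.
  by rewrite sumr_ge0// => c _; exact: powR_ge0.
- apply: ler_powRl => //; first exact/ltW/w_gt0.
  apply: (le_trans (ler_norm _)); apply: wM => //.
  by rewrite (le_lt_trans (ler_norm _))// ltrDl.
- apply: sd_error_le => // c; rewrite ler_wsqrtr//.
  exact: posterior_var_le.
Qed.

Lemma error_int_gt0 v : nonneg_orthant v -> 0 < error_int v.
Proof.
move=> v0; apply: Rintegral_gt0 => // [|p]; first exact: bmeasurable_integrand.
exact: integrand_gt0.
Qed.

Let sds_convex u v p c t : nonneg_orthant u -> nonneg_orthant v ->
  0 <= t -> t <= 1 ->
  sds (t *: u + (1 - t) *: v) p c <= t * sds u p c + (1 - t) * sds v p c.
Proof. by move=> u0 v0 t0 t1; exact: posterior_sd_convex. Qed.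

Lemma integrand_convex u v p t : nonneg_orthant u -> nonneg_orthant v ->
  0 <= t -> t <= 1 ->
  integrand (t *: u + (1 - t) *: v) p <= t * integrand u p + (1 - t) * integrand v p.
Proof.
move=> u0 v0 t0 t1.
have le_sd : sd_error em q (sds (t *: u + (1 - t) *: v) p) <=
    t * sd_error em q (sds u p) + (1 - t) * sd_error em q (sds v p).
  apply: (@le_trans _ _ (sd_error em q
      (fun c => t * sds u p c + (1 - t) * sds v p c))).
    by apply: sd_error_le => // c; exact: sds_convex.
  exact: sd_error_convex.
exact: (ler_wpM2l_conv (powR_ge0 _ _) le_sd).
Qed.

Lemma error_gt0 v : nonneg_orthant v -> 0 < error v.
Proof. by move=> v0; rewrite powR_gt0 ?error_int_gt0. Qed.

Lemma error_powR v : nonneg_orthant v -> error v `^ q = error_int v.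
Proof.
move=> v0; rewrite /error -powRrM mulVf ?gt_eqF// powRr1// ltW//.
exact: error_int_gt0.
Qed.

(* Minkowski's inequality by normalisation: sd_error is convex and homogeneous
   of degree q, so it suffices to rescale u and v to unit error. *)
Lemma error_le_conv u v z t : nonneg_orthant u -> nonneg_orthant v ->
  nonneg_orthant z -> 0 <= t -> t <= 1 ->
  (forall p c, sds z p c <= t * sds u p c + (1 - t) * sds v p c) ->
  error z <= t * error u + (1 - t) * error v.
Proof.
move=> u0 v0 z0 t0 t1 le_sd.
have t1' : 0 <= 1 - t by rewrite subr_ge0.
have := error_gt0 u0; have := error_gt0 v0; have := error_powR u0; have := error_powR v0.
move: (error u) (error v) => a b bE aE b0 a0.
have [e eE] : exists e : R, e = t * a + (1 - t) * b by eexists.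
rewrite -eE.
have e0 : 0 < e.
  rewrite eE; have [->|tn0] := eqVneq t 0; first by rewrite mul0r add0r subr0 mul1r.
  by rewrite ltr_pwDl ?mulr_ge0 ?(ltW b0)// mulr_gt0// lt_neqAle eq_sym tn0.
(* With this weight t x + (1 - t) y = e (l (x / a) + (1 - l) (y / b)), a convex combination of
   deviations rescaled to unit error. *)
have [l lE] : exists l : R, l = t * a / e by eexists.
have l1E : 1 - l = (1 - t) * b / e by rewrite lE eE; field; rewrite -eE gt_eqF.
have l0 : 0 <= l by rewrite lE divr_ge0 ?mulr_ge0// ltW.
have l1 : l <= 1 by rewrite -subr_ge0 l1E divr_ge0 ?mulr_ge0// ltW.
have ia0 : 0 <= a^-1 by rewrite invr_ge0 ltW.
have ib0 : 0 <= b^-1 by rewrite invr_ge0 ltW.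
have ia : a^-1 `^ q * error_int u = 1.
  rewrite -aE -powRM ?(ltW a0)// mulVf ?powR1//; exact: lt0r_neq0.
have ib : b^-1 `^ q * error_int v = 1.
  rewrite -bE -powRM ?(ltW b0)// mulVf ?powR1//; exact: lt0r_neq0.
have := error_powR z0; have := error_gt0 z0.
move: (error z) => ez ez0 ezE.
suff le_z : error_int z <= e `^ q.
  rewrite leNgt; apply/negP => lt_e.
  by have := ltr_powRl q_gt0 (ltW e0) lt_e; rewrite ezE ltNge le_z.
have pointwise p : integrand z p <=
    (e `^ q * l * a^-1 `^ q) * integrand u p +
    (e `^ q * (1 - l) * b^-1 `^ q) * integrand v p.
  have sz c : sds z p c <= e * (l * (a^-1 * sds u p c) + (1 - l) * (b^-1 * sds v p c)).
    apply: (le_trans (le_sd p c)); rewrite l1E lE.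
    move: (sds u p c) (sds v p c) => x y.
    rewrite le_eqVlt; apply/orP; left; apply/eqP; field.
    by rewrite !gt_eqF.
  have su : sd_error em q (fun c => a^-1 * sds u p c) =
      a^-1 `^ q * sd_error em q (sds u p) by exact: sd_error_scale.
  have sv : sd_error em q (fun c => b^-1 * sds v p c) =
      b^-1 `^ q * sd_error em q (sds v p) by exact: sd_error_scale.
  have se : sd_error em q (fun c => e * (l * (a^-1 * sds u p c) + (1 - l) * (b^-1 * sds v p c)))
      = e `^ q * sd_error em q (fun c => l * (a^-1 * sds u p c) + (1 - l) * (b^-1 * sds v p c)).
    apply: sd_error_scale => // [|c]; first exact: ltW.
    by apply: addr_ge0; (apply: mulr_ge0; last apply: mulr_ge0); rewrite ?subr_ge0.
  have sc : sd_error em q (fun c => l * (a^-1 * sds u p c) + (1 - l) * (b^-1 * sds v p c)) <=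
      l * sd_error em q (fun c => a^-1 * sds u p c) +
      (1 - l) * sd_error em q (fun c => b^-1 * sds v p c).
    by apply: sd_error_convex => // c; apply: mulr_ge0.
  have : sd_error em q (sds z p) <= e `^ q *
     (l * (a^-1 `^ q * sd_error em q (sds u p)) +
      (1 - l) * (b^-1 `^ q * sd_error em q (sds v p))).
    have := sd_error_le em hm hq (sds_ge0 z p) sz; rewrite se => /le_trans; apply.
    by rewrite -su -sv; apply: ler_wpM2l => //; exact: powR_ge0.
  exact: (ler_wpM2l_comb (powR_ge0 _ _)).
have bz := bmeasurable_integrand z0.
have bu := bmeasurable_integrand u0; have bv := bmeasurable_integrand v0.
have : error_int z <= (e `^ q * l * a^-1 `^ q) * error_int u +
    (e `^ q * (1 - l) * b^-1 `^ q) * error_int v.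
  rewrite /error_int -Rintegral_linear//.
  apply: (bmeasurable_le mX Xoo bz); last by move=> p _; exact: pointwise.
  by apply: bmeasurableD; apply: bmeasurableZ.
move=> /le_trans; apply; rewrite -!mulrA ia ib !mulr1 -mulrDr.
by rewrite addrC subrK mulr1.
Qed.

Lemma error_convex u v t : nonneg_orthant u -> nonneg_orthant v ->
  0 <= t -> t <= 1 ->
  error (t *: u + (1 - t) *: v) <= t * error u + (1 - t) * error v.
Proof.
move=> u0 v0 t0 t1; apply: error_le_conv => //; first exact: nonneg_orthant_conv.
by move=> p c; exact: sds_convex.
Qed.

Let k00 : R := \sum_c k c 0 0.

Let dist1 u v : R := \sum_i `|u ord0 i - v ord0 i|.

Let k00_ge0 : 0 <= k00.
Proof. by apply: sumr_ge0 => c _; rewrite ltW// kernel_diag_gt0. Qed.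

Let dist1_ge0 u v : 0 <= dist1 u v.
Proof. exact: sumr_ge0. Qed.

Let k00_ge c : k c 0 0 <= k00.
Proof.
rewrite /k00 (bigD1 c)//= lerDl sumr_ge0// => l _.
by rewrite ltW// kernel_diag_gt0.
Qed.

Let sds_lipschitz u v p c : nonneg_orthant u -> nonneg_orthant v ->
  sds v p c <= Num.sqrt (1 + k00 * dist1 u v) * sds u p c.
Proof.
move=> u0 v0; have h0 : 0 <= 1 + k00 * dist1 u v by rewrite addr_ge0// mulr_ge0.
rewrite -sqrtrM// ler_wsqrtr//.
apply: (le_trans (posterior_var_lipschitz pts_inj (k_cov c) p u0 v0)).
rewrite mulrC; apply: ler_wpM2r; first exact/ltW/posterior_var_gt0.
rewrite lerD2l; apply: ler_wpM2r; [exact: dist1_ge0|exact: k00_ge].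
Qed.

(** The deviations grow by at most the factor sqrt r, uniformly in p, so by homogeneity the error
    does too; and sqrt r <= r because r >= 1. *)
Lemma error_lipschitz u v : nonneg_orthant u -> nonneg_orthant v ->
  error v <= (1 + k00 * dist1 u v) * error u.
Proof.
move=> u0 v0; set r := 1 + _.
have r1 : 1 <= r by rewrite lerDl mulr_ge0.
have r0 : 0 <= r by exact: le_trans r1.
have le_int : error_int v <= Num.sqrt r `^ q * error_int u.
  rewrite -RintegralZl//; last exact/bmeasurable_integrable/bmeasurable_integrand.
  apply: (bmeasurable_le mX Xoo (bmeasurable_integrand v0)).
    by apply: bmeasurableZ; exact: bmeasurable_integrand.
  by move=> p _; apply: integrand_le => // c; exact: sds_lipschitz.
have sr : Num.sqrt r <= r.
  rewrite -{2}(sqr_sqrtr r0) expr2 -{1}(mulr1 (Num.sqrt r)) ler_wpM2l//.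
  by rewrite -(@sqrtr1 R) ler_wsqrtr.
apply: (@le_trans _ _ (Num.sqrt r * error u)); last first.
  by rewrite ler_wpM2r// ltW// error_gt0.
rewrite /error -[X in X * _](_ : (Num.sqrt r `^ q) `^ q^-1 = _); last first.
  by rewrite -powRrM mulfV ?gt_eqF// powRr1.
rewrite -powRM ?powR_ge0//; last by rewrite ltW// error_int_gt0.
by rewrite ler_powRl ?invr_ge0// ltW// error_int_gt0.
Qed.

Lemma error_antitone_le v : nonneg_orthant v -> error v <= error 0.
Proof.
move=> v0; have z0 : nonneg_orthant (0 : 'rV[R]_N) by move=> i; rewrite mxE.
apply: ler_powRl; [by rewrite invr_ge0|exact/ltW/error_int_gt0|].
apply: (bmeasurable_le mX Xoo (bmeasurable_integrand v0) (bmeasurable_integrand z0)).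
move=> p _; have -> : integrand 0 p = 1 `^ q * integrand 0 p by rewrite powR1 mul1r.
apply: integrand_le => // c.
rewrite mul1r ler_wsqrtr//; apply: posterior_var_antitone => // i.
by rewrite mxE.
Qed.

Lemma error_continuous_within (A : set 'rV[R]_N) :
  A `<=` @nonneg_orthant R N -> {within A, continuous error}.
Proof.
move=> A0; apply/subspace_continuousP => v Av.
have v0 := A0 _ Av.
apply/cvgrPdist_le => e e0.
(* The error at 0 dominates all others, so [error_lipschitz] bounds the change on a ball of radius e
   / L by (L - 1) e / L. The summand 1 keeps L positive. *)
pose L := k00 * error 0 * N%:R + 1.
have E0_ge0 : 0 <= error 0 by exact: powR_ge0.
have L0 : 0 < L by rewrite ltr_wpDl// !mulr_ge0.
have dL u : A u -> ball v (e / L) u -> `|error v - error u| <= e.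
  move=> Au vu; have u0 := A0 _ Au.
  have lip a b : nonneg_orthant a -> nonneg_orthant b ->
      dist1 a b <= N%:R * (e / L) -> error b - error a <= e.
    move=> a0 b0 dab.
    rewrite lerBlDr (le_trans (error_lipschitz a0 b0))// mulrDl mul1r addrC lerD2r.
    apply: (@le_trans _ _ (k00 * (N%:R * (e / L)) * error 0)).
      apply: ler_pM; rewrite ?powR_ge0 ?mulr_ge0 ?error_antitone_le//.
      by rewrite ler_wpM2l.
    have -> : k00 * (N%:R * (e / L)) * error 0 = (L - 1) * (e / L) by rewrite /L; ring.
    rewrite -[leRHS](divfK (lt0r_neq0 L0)) [leRHS]mulrC ler_wpM2r//.
      by rewrite divr_ge0 ?ltW.
    by rewrite gerBl.
  have duv (a b : 'rV[R]_N) : (forall i, `|a ord0 i - b ord0 i| <= e / L) ->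
      dist1 a b <= N%:R * (e / L).
    move=> ab; rewrite /dist1 -[X in X%:R](card_ord N) mulr_natl -sumr_const.
    by apply: ler_sum => i _.
  case: vu => _ vu; rewrite ler_norml; apply/andP; split.
    rewrite lerNl opprB; apply: lip => //; apply: duv => i.
    by have := vu ord0 i => /ltW.
  apply: lip => //; apply: duv => i; rewrite distrC.
  by have := vu ord0 i => /ltW.
have : nbhs v (ball v (e / L)).
  by apply: nbhsx_ballx; rewrite divr_gt0.
by apply: filterS => u vu Au; exact: dL.
Qed.

(** * Strict improvement by exchange *)

Hypothesis k_pos : forall c, strictly_positive (k c).

(** With step 1 / (n + 1) from v towards z, the difference quotients of a convex function are (n +
    1) (f (segment v z n) - f v) and decrease in n. *)
Definition segment v (z : 'rV[R]_N) n : 'rV[R]_N := n.+1%:R^-1 *: z + (1 - n.+1%:R^-1) *: v.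

Let inv_nat01 n : 0 < (n.+1%:R^-1 : R) /\ (n.+1%:R^-1 : R) <= 1.
Proof. by rewrite invr_gt0 invf_le1 ?ler1n. Qed.

Let segment_split x z a b : (a <= b)%N -> exists t : R,
  [/\ 0 <= t, t <= 1, b.+1%:R * t = a.+1%:R &
    segment x z b = t *: segment x z a + (1 - t) *: x].
Proof.
move=> ab; have na : (0 : R) < a.+1%:R by rewrite ltr0n.
have nb : (0 : R) < b.+1%:R by rewrite ltr0n.
exists (a.+1%:R / b.+1%:R); split.
- by rewrite divr_ge0// ltW.
- by rewrite ler_pdivrMr// mul1r ler_nat.
- by rewrite mulrCA divff ?mulr1// gt_eqF.
- by apply/rowP => l; rewrite !mxE; field; rewrite !lt0r_neq0.
Qed.

Let segment_ge0 v z n : nonneg_orthant v -> nonneg_orthant z ->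
  nonneg_orthant (segment v z n).
Proof. by move=> v0 z0; have [/ltW ? ?] := inv_nat01 n; exact: nonneg_orthant_conv. Qed.

(** The tangent bounds at z towards u and v have opposite sums, so they average to midpoint
    convexity. Without a gap the bound towards u is an equality, and u_i - z_i = (u_i - v_i) / 2 is
    nonzero. *)
Lemma posterior_var_midpoint u v p c : nonneg_orthant u -> nonneg_orthant v ->
  let z := 2^-1 *: u + (1 - 2^-1) *: v in
  posterior_var pts z (k c) p <=
    (posterior_var pts u (k c) p + posterior_var pts v (k c) p) / 2 /\
  ((posterior_var pts u (k c) p + posterior_var pts v (k c) p) / 2 <=
    posterior_var pts z (k c) p ->
  forall i, u ord0 i != v ord0 i -> post_cov pts (k c) z p i ord0 = 0).
Proof.
move=> u0 v0 z; have half := onem_half R.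
have z0 : nonneg_orthant z.
  by apply: nonneg_orthant_conv => //; rewrite ?invr_ge0// invf_le1// ler1n.
have zE i : z ord0 i = (u ord0 i + v ord0 i) / 2.
  by rewrite !mxE half; ring.
have := posterior_var_tangent pts_inj (k_cov c) p v0 z0.
have := posterior_var_tangent pts_inj (k_cov c) p u0 z0.
have := posterior_var_tangent_eq pts_inj (k_cov c) (p := p) u0 z0.
set Su := \sum_i _; set Sv := \sum_i _.
have S0 : Sv = - Su.
  by rewrite /Su /Sv -sumrN; apply: eq_bigr => i _; rewrite zE; field.
rewrite S0 => eq_u le_u le_v; split; first exact: le_half le_u le_v.
move=> le_z i uvi; have /eqP := eq_u (half_le_tangent le_v le_z) i.
rewrite mulf_eq0 zE => /orP[|/eqP//].
have -> : u ord0 i - (u ord0 i + v ord0 i) / 2 = (u ord0 i - v ord0 i) / 2.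
  by field.
by rewrite mulf_eq0 subr_eq0 (negbTE uvi) invr_eq0 pnatr_eq0.
Qed.

(** First move coordinate i alone to y_i, possibly downwards: since h_i = 0 this changes neither the
    variance nor the resolvent. Then raise the other coordinates, which strictly lowers the
    variance. *)
Lemma posterior_var_exchange v y p c i : nonneg_orthant v -> nonneg_orthant y ->
  post_cov pts (k c) v p i ord0 = 0 ->
  (forall l, l != i -> v ord0 l < y ord0 l) ->
  posterior_var pts y (k c) p < posterior_var pts v (k c) p.
Proof.
move=> v0 y0 hi vy.
pose x : 'rV[R]_N := \row_l if l == i then y ord0 i else v ord0 l.
have xi : x ord0 i = y ord0 i by rewrite mxE eqxx.
have xl l : l != i -> x ord0 l = v ord0 l by rewrite mxE => /negbTE ->.
have x0 : nonneg_orthant x by move=> l; rewrite mxE; case: ifP.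
have [<- hx] : posterior_var pts x (k c) p = posterior_var pts v (k c) p /\
    post_cov pts (k c) x p = post_cov pts (k c) v p.
  apply: posterior_var_eq => // l.
  have [->|/xl ->] := eqVneq l i; first by rewrite hi mulr0.
  by rewrite subrr mul0r.
apply: (posterior_var_lt pts_inj (k_cov c) (i := i)) => //.
- exact: k_pos.
- by rewrite hx.
- by move=> l li; rewrite xl// vy.
Qed.

(** Without a midpoint gap every active component has h_i = 0 and decreases strictly for all n. An
    inactive component only has to stay below a larger one, which holds for n large; there are
    finitely many components, so one n serves all. *)
Lemma integrand_exchange u v z p i : X p ->
  nonneg_orthant u -> nonneg_orthant v -> nonneg_orthant z ->
  u ord0 i != v ord0 i ->
  let x := 2^-1 *: u + (1 - 2^-1) *: v in
  (forall l, l != i -> x ord0 l < z ord0 l) ->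
  (integrand u p + integrand v p) / 2 <= integrand x p ->
  exists n, integrand (segment x z n) p < integrand x p.
Proof.
move=> Xp u0 v0 z0 uvi x xz le_x.
have x0 : nonneg_orthant x.
  by apply: nonneg_orthant_conv => //; rewrite ?invr_ge0// invf_le1// ler1n.
have le_sd : (sd_error em q (sds u p) + sd_error em q (sds v p)) / 2 <=
    sd_error em q (sds x p).
  have wq : 0 < w p `^ q by rewrite powR_gt0// w_gt0.
  by rewrite -(ler_pM2l wq); apply: le_trans le_x; rewrite mulrA mulrDr.
have mid c : posterior_var pts x (k c) p <=
    (posterior_var pts u (k c) p + posterior_var pts v (k c) p) / 2.
  by have [] := posterior_var_midpoint p c u0 v0.
have mid_sds c : sds x p c ^+ 2 <= (sds u p c ^+ 2 + sds v p c ^+ 2) / 2.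
  by rewrite (sds_sqr p c u0) (sds_sqr p c v0) (sds_sqr p c x0); exact: mid.
have act0 c : active em (sds x p) c -> post_cov pts (k c) x p i ord0 = 0.
  move=> act; have [_ /(_ _ i uvi)] := posterior_var_midpoint p c u0 v0; apply.
  have := sd_error_midpoint_active hm hq (sds_ge0 x p) (sds_ge0 u p)
    (sds_ge0 v p) mid_sds le_sd act.
  rewrite (sds_sqr p c u0) (sds_sqr p c v0) (sds_sqr p c x0) => e.
  by rewrite -/x e lexx.
have act_lt c n : active em (sds x p) c -> sds (segment x z n) p c < sds x p c.
  move=> act; rewrite ltr_sqrt ?posterior_var_gt0//.
  apply: (@posterior_var_exchange _ _ _ _ i) => //; first exact: segment_ge0.
    exact: act0.
  move=> l /xz xzl; have [t0 _] := inv_nat01 n.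
  have -> : segment x z n ord0 l =
      x ord0 l + n.+1%:R^-1 * (z ord0 l - x ord0 l) by rewrite !mxE; ring.
  by rewrite ltrDl mulr_gt0// subr_gt0.
have inact_lt c : \forall n \near \oo, ~ active em (sds x p) c ->
    exists c', sds (segment x z n) p c < sds x p c'.
  have [act|] := pselect (active em (sds x p) c); first exact: nearW.
  rewrite /active; case: em => [/existsNP[c' /negP]|//]; rewrite -ltNge => cc'.
  set a := sds x p c in cc' *; set b := sds x p c' in cc' *.
  have a0 : 0 <= a by exact: sds_ge0.
  (* By [sds_lipschitz] the squared deviation of component c exceeds a^2 by at most L / (n + 1). The
     threshold is divided by L + 1, which is positive even when L = 0. *)
  pose L := k00 * dist1 x z * a ^+ 2.
  have L0 : 0 <= L by rewrite mulr_ge0 ?sqr_ge0// mulr_ge0.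
  have ab : 0 < b ^+ 2 - a ^+ 2.
    by rewrite subr_gt0 ltr_pXn2r// nnegrE (le_trans a0)// ltW.
  have e0 : 0 < (b ^+ 2 - a ^+ 2) / (L + 1) by rewrite divr_gt0// ltr_wpDl.
  apply: filterS (near_infty_natSinv_lt (PosNum e0)) => n /= tn _; exists c'.
  have [t0 t1] := inv_nat01 n.
  apply: (le_lt_trans (sds_lipschitz p c x0 (segment_ge0 n x0 z0))).
  have -> : dist1 x (segment x z n) = n.+1%:R^-1 * dist1 x z.
    rewrite /dist1 mulr_sumr; apply: eq_bigr => l _.
    rewrite -[X in _ = X * _](ger0_norm (ltW t0)) -normrM; congr (`|_|).
    by rewrite !mxE; ring.
  rewrite -/a -{1}(ger0_norm a0) -sqrtr_sqr -sqrtrM; last first.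
    by rewrite addr_ge0// !mulr_ge0// ltW.
  have b0 : 0 <= b by exact: sds_ge0.
  rewrite -[ltRHS](ger0_norm b0) -sqrtr_sqr ltr_sqrt; last first.
    by rewrite exprn_gt0// (le_lt_trans a0).
  have L1 : 0 < L + 1 by rewrite ltr_wpDl.
  move: tn; rewrite (ltr_pdivlMr _ _ L1) ltrBrDl => tn.
  have -> : (1 + k00 * (n.+1%:R^-1 * dist1 x z)) * a ^+ 2 =
    a ^+ 2 + n.+1%:R^-1 * (L + 1) - n.+1%:R^-1 by rewrite /L; ring.
  by rewrite ltrBlDr (lt_trans tn)// ltrDl.
have [n Pn] : exists n, forall c, ~ active em (sds x p) c ->
    exists c', sds (segment x z n) p c < sds x p c'.
  have : \forall n \near \oo, forall c, ~ active em (sds x p) c ->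
      exists c', sds (segment x z n) p c < sds x p c'.
    by apply: filter_forall => c; exact: inact_lt.
  by move=> [n _ /(_ n (leqnn n)) Pn]; exists n.
exists n; rewrite ltr_pM2l ?powR_gt0 ?w_gt0//.
by apply: sd_error_lt => // c; exact: act_lt.
Qed.

(** If no point of the segment improved on u, all slopes [r n] would have nonnegative integral,
    hence be nonnegative together at some p. Letting n grow, there is no midpoint gap at p, and
    [integrand_exchange] contradicts [r n p] >= 0. *)
Lemma exchange_decreases_error u v z i :
  nonneg_orthant u -> nonneg_orthant v -> nonneg_orthant z ->
  u ord0 i != v ord0 i -> error u = error v ->
  let x := 2^-1 *: u + (1 - 2^-1) *: v in
  (forall l, l != i -> x ord0 l < z ord0 l) ->
  exists n, error (segment x z n) < error u.
Proof.
move=> u0 v0 z0 uvi uv x xz.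
have half0 : 0 <= (2^-1 : R) by rewrite invr_ge0.
have half1 : (2^-1 : R) <= 1 by rewrite invf_le1 ?ler1n.
have half := onem_half R.
have x0 : nonneg_orthant x by exact: nonneg_orthant_conv.
apply: contrapT => Nlt.
have ge_u n : error u <= error (segment x z n).
  by rewrite leNgt; apply/negP => lt_n; apply: Nlt; exists n.
have s0 n : nonneg_orthant (segment x z n) by exact: segment_ge0.
pose H p := 2^-1 * integrand u p + (1 - 2^-1) * integrand v p.
have xH p : integrand x p <= H p by exact: integrand_convex.
(* r n p is the slope of the convex integrand from x towards z, minus n.+1 times
   the midpoint gap H p - integrand x p. *)
pose r n p := n.+1%:R * integrand (segment x z n) p + (- n.+1%:R) * H p.
have bH : bmeasurable (X : set (lebesgue_rVType R d)) H.
  apply: bmeasurableD; apply: bmeasurableZ; exact: bmeasurable_integrand.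
have br n : bmeasurable (X : set (lebesgue_rVType R d)) (r n).
  apply: bmeasurableD; apply: bmeasurableZ; last exact: bH.
  exact: bmeasurable_integrand.
have intH : \int[mu]_(p in X) H p = error_int u.
  transitivity (2^-1 * error_int u + (1 - 2^-1) * error_int v).
    exact: (Rintegral_linear mX Xoo _ _ (bmeasurable_integrand u0)
      (bmeasurable_integrand v0)).
  rewrite -(error_powR u0) -(error_powR v0) uv -mulrDl.
  by rewrite addrC subrK mul1r.
have int_r n : 0 <= \int[mu]_(p in X) r n p.
  have -> : \int[mu]_(p in X) r n p =
      n.+1%:R * error_int (segment x z n) + (- n.+1%:R) * error_int u.
    rewrite -intH.
    exact: (Rintegral_linear mX Xoo _ _ (bmeasurable_integrand (s0 n)) bH).
  apply: (scaled_gap_ge0 _ _ (ltr0Sn R n)).2.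
  rewrite -(error_powR u0) -(error_powR (s0 n)).
  exact: (ler_powRl q_ge0 (ltW (error_gt0 u0)) (ge_u n)).
(* The slopes of the convex integrand decrease with n, and subtracting n + 1 times the nonnegative
   gap preserves this. *)
have decr p : X p -> {homo r^~ p : a b / (a <= b)%N >-> b <= a}.
  move=> Xp a b ab.
  have [t [t0 t1 bt segE]] := segment_split x z ab.
  have := integrand_convex p (s0 a) x0 t0 t1; rewrite -segE => le_b.
  have le_H : t * integrand (segment x z a) p + (1 - t) * integrand x p <=
      t * integrand (segment x z a) p + (1 - t) * H p.
    apply: lerD; first exact: lexx.
    by apply: ler_wpM2l; [rewrite subr_ge0|exact: xH].
  exact: scaled_gap_le (ler0n _ _) bt (le_trans le_b le_H).
have [p Xp rp] := Rintegral_nonincreasing_ge0 mX Xoo X_pos br decr int_r.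
have ge_H n : H p <= integrand (segment x z n) p.
  exact: ((scaled_gap_ge0 (integrand (segment x z n) p) (H p) (ltr0Sn R n)).1 (rp n)).
have HE : H p = (integrand u p + integrand v p) / 2.
  by rewrite /H half -mulrDr mulrC.
(* By convexity the integrand at [segment x z n] is at most its value at x plus a term of order 1 /
   (n + 1), too small to bridge a positive gap. *)
have Hx : H p <= integrand x p.
  rewrite leNgt; apply/negP => lt_x.
  have e0 : 0 < H p - integrand x p by rewrite subr_gt0.
  have e1 : 0 < (H p - integrand x p) / (`|integrand z p - integrand x p| + 1).
    by rewrite divr_gt0// ltr_wpDl.
  have [n _ /(_ n (leqnn n)) /= tn] := near_infty_natSinv_lt (PosNum e1).
  have [t0 t1] := inv_nat01 n.
  have L1 : 0 < `|integrand z p - integrand x p| + 1 by rewrite ltr_wpDl.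
  move: tn; rewrite (ltr_pdivlMr _ _ L1).
  move=> /(conv_gap_lt t0 (ler_norm _)); rewrite ltNge => /negP; apply.
  exact: le_trans (ge_H n) (integrand_convex p z0 x0 (ltW t0) t1).
have [] := @integrand_exchange u v z p i Xp u0 v0 z0 uvi xz.
  by rewrite -HE.
move=> n; rewrite -/x ltNge => /negP; apply.
exact: le_trans (xH p) (ge_H n).
Qed.

End design_problem.

(** * Convexity, existence and uniqueness for the design problem *)

Theorem corollary3p2p1 (R : realType) (d n j m : nat) (X : set 'rV[R]_d)
    (pts : 'I_(n + j) -> 'rV[R]_d) (eps : 'I_n -> R)
    (k : 'I_m -> 'rV[R]_d -> 'rV[R]_d -> R) (w : 'rV[R]_d -> R)
    (em : error_model) (q s DW : R)
    (hm : (0 < m)%N)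
    (X_closed : closed X) (X_bounded : bounded_set X)
    (X_pos : (0 < lebesgue_rV X)%E)
    (pts_inj : injective pts) (pts_X : forall i, X (pts i))
    (eps_gt0 : forall i, 0 < eps i)
    (k_cov : forall c, covariance_kernel (k c))
    (w_gt0 : forall p, X p -> 0 < w p)
    (w_bounded : [bounded w p | p in X])
    (w_meas : measurable_fun (X : set (lebesgue_rVType R d)) w)
    (hq : 2 <= q) (hs : 1 <= s) (hDW : 0 < DW) :
  let E := total_error em q X w pts k in
  let A := admissible s DW eps in
  [/\ convex_function (@nonneg_orthant R (n + j)) E,
      convex_set A &
      (forall c, strictly_positive (k c)) ->
      exists! v, is_minimizer A E v].
Proof.
move=> E A.
have EE : E = error X pts k w em q by apply/funext => v; rewrite /E total_errorE.
clearbody E.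
have AO : A `<=` @nonneg_orthant R (n + j) by move=> v [].
have conv (u v : 'rV[R]_(n + j)) (t : R) : nonneg_orthant u -> nonneg_orthant v ->
    0 <= t -> t <= 1 -> E (t *: u + (1 - t) *: v) <= t * E u + (1 - t) * E v.
  by rewrite EE; exact: error_convex.
split.
- move=> t u v /set_mem u0 /set_mem v0.
  exact: conv.
- exact: admissible_convex_set.
move=> k_pos.
have [v Av minv] : exists2 v, v \in A & forall u, u \in A -> E v <= E u.
  apply: EVT_min_rV.
  - exact: admissible_nonempty.
  - exact: admissible_compact.
  - by rewrite EE; exact: error_continuous_within.
have minE u : A u -> E v <= E u by move=> /mem_set/minv.
move/set_mem: Av => Av.
exists v; split => [|v' [Av' minv']]; first by split.
apply: contrapT => vv'.
have Ev'v : E v' = E v.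
  by apply/le_anti/andP; split; [exact: (minv' _ Av)|exact: (minE _ Av')].
(* Two minimisers cannot differ in either direction at any coordinate; the statement is symmetric so
   that it can be applied both ways. *)
have no_lt u u' i : A u -> A u' -> E u = E v -> E u' = E v ->
    u' ord0 i < u ord0 i -> False.
  move=> Au Au' Eu Eu' lt_i.
  have [z [Az xz]] := admissible_exchange hs Au Au' lt_i.
  have u_neq : u ord0 i != u' ord0 i by rewrite gt_eqF.
  have Euu' : error X pts k w em q u = error X pts k w em q u'.
    by rewrite -EE Eu Eu'.
  have [l] := exchange_decreases_error hm X_closed X_bounded X_pos pts_inj k_cov
    w_gt0 w_bounded w_meas hq k_pos (AO _ Au) (AO _ Au') (AO _ Az) u_neq Euu' xz.
  (* The improved point lies between the midpoint and z, so it is admissible by convexity. *)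
  rewrite -EE Eu ltNge => /negP; apply; apply: minE.
  have half1 : (2^-1 : R) <= 1 by rewrite invf_le1 ?ler1n.
  apply: (admissible_conv hs _ _ Az); first by rewrite invr_ge0 ler0n.
    by rewrite invf_le1 ?ler1n ?ltr0n.
  by apply: (admissible_conv hs _ half1 Au Au'); rewrite invr_ge0.
apply: vv'; apply/rowP => i; apply/eqP; rewrite eq_le.
apply/andP; split; rewrite leNgt; apply/negP => lt_i.
- exact: (no_lt v v' i Av Av' erefl Ev'v lt_i).
- exact: (no_lt v' v i Av' Av Ev'v erefl lt_i).
Qed.
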